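(* Let $r_1,q_1,r_2,q_2\in\mathbb{N}$ with $r_1\le q_1$, $r_2\le q_2$, and let $\tilde\Delta_2(x)=\Delta_2(x;r_1,q_1,r_2,q_2)$. Then for every non-negative integer $k$, $$\int_{1}^{\infty}\frac{\log^kx - k \log^{k-1}x}{x^2}\tilde{\Delta}_{2}(x)\, dx = \sum_{i=0}^{k}\binom{k}{i}\gamma_{k-i}(r_2,q_2)\gamma_i(r_1,q_1) + \left\lfloor \frac{1}{k+1} \right\rfloor \left( \frac{1}{q_1q_2}-\frac{\gamma_0(r_1,q_1)}{q_2} - \frac{\gamma_0(r_2,q_2)}{q_1} \right) - \frac{\gamma_{k+1}(r_2,q_2)}{q_1(k+1)}-\frac{\gamma_{k+1}(r_1,q_1)}{q_2(k+1)},$$ and for every $\alpha\in\left(\frac{131}{416},1\right)$, $$\int_{1}^{\infty}\frac{\alpha\log^kx - k \log^{k-1}x}{x^{1+\alpha}}\tilde{\Delta}_{2}(x)\, dx = \sum_{l=0}^{k}\zeta_l(\alpha,r_1,q_1)\zeta_{k-l}(\alpha,r_2,q_2) +\left\lfloor \frac{1}{k+1} \right\rfloor \left( \frac{1}{q_1q_2}-\frac{\gamma_0(r_1,q_1)}{q_2} - \frac{\gamma_0(r_2,q_2)}{q_1} \right) - \frac{1}{q_1q_2}\cdot\frac{(k+1)!}{(\alpha-1)^{k+2}} - \left( \frac{\gamma_0(r_1,q_1)}{q_2} + \frac{\gamma_0(r_2,q_2)}{q_1} \right)\frac{k!}{(\alpha-1)^{k+1}}.$$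
   Context: $\lfloor 1/(k+1)\rfloor$ is $1$ for $k=0$ and $0$ otherwise; for $k=0$ the terms $k\log^{k-1}x$ vanish. $\zeta(s;r,q)=\sum_{n\ge1,\,n\equiv r\bmod q}n^{-s}$ for $\Re s>1$, meromorphically continued. $d_*(n)$ is the number of pairs $(n_1,n_2)\in\mathbb{N}^2$ with $n=n_1n_2$, $n_1\equiv r_1 \bmod q_1$, $n_2\equiv r_2\bmod q_2$, and $$\Delta_2(x;r_1,q_1,r_2,q_2)=\sum_{n\le x}d_*(n)-\mathrm{Res}_{s=1}\Big(\zeta(s;r_1,q_1)\zeta(s;r_2,q_2)\frac{x^s}{s}\Big).$$ The generalized Euler–Lehmer constants are $\gamma_k(r,q):=\lim_{x\to\infty}\Big(\sum_{n\le x,\,n\equiv r\bmod q}\frac{\log^k n}{n}-\frac{\log^{k+1}x}{q(k+1)}\Big)$. For $\alpha\in(0,1)$: $\zeta_k(\alpha,r,q):=\lim_{x\to\infty}\Big(\sum_{1\le n\le x,\ n\equiv r \bmod q}\frac{\log^k n}{n^{\alpha}}-\frac{I_k(x,\alpha)}{q}\Big)$, with $I_k(x,\alpha)=x^{1-\alpha}\sum_{i=0}^{k}(-1)^i\frac{k!}{(k-i)!}\frac{\log^{k-i}x}{(1-\alpha)^{i+1}}$.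
   Formalization: In the second formula the sum over l is taken with the binomial coefficient C(k,l), i.e. sum of C(k,l) ζ_l(α,r1,q1) ζ_{k-l}(α,r2,q2); as printed, without it, the formula fails for k=2 (e.g. r_i=q_i=1, α=1/2), while for k=0,1 both agree. *)

(* Defs.v *)
From Stdlib Require Import Reals Arith List ClassicalEpsilon.
From Coquelicot Require Import Coquelicot.
Open Scope R_scope.

Definition congr (n r q : nat) : bool := Nat.eqb (n mod q) (r mod q).

(* The sum of [f n] over the integers [1 <= n <= x]; it is [0] for [x < 1]. *)
Definition sum_upto (f : nat -> R) (x : R) : R :=
  sum_n_m f 1 (Z.to_nat (Int_part x)).

Definition sum_upto_ap (f : nat -> R) (r q : nat) (x : R) : R :=
  sum_upto (fun n => if congr n r q then f n else 0) x.

Definition Cexp (z : C) : C := (exp (Re z) * cos (Im z), exp (Re z) * sin (Im z)).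

(* [x ^ s] for real [x > 0] and complex [s]. *)
Definition Rcpower (x : R) (s : C) : C := Cexp (RtoC (ln x) * s)%C.

(* [f s = sum_(n >= 0) a n * (s - z0) ^ (n - N)] on a punctured disc at [z0]. *)
Definition laurent_at (f : C -> C) (z0 : C) (N : nat) (a : nat -> C) : Prop :=
  exists delta : R, 0 < delta /\
    forall s : C, 0 < Cmod (s - z0)%C < delta ->
      is_pseries (K := C_AbsRing) (V := C_NormedModule)
        a (s - z0)%C (Cmult (Cpow (s - z0)%C N) (f s)).

Definition meromorphic_at (f : C -> C) (z0 : C) : Prop :=
  exists (N : nat) (a : nat -> C), laurent_at f z0 N a.

(* In a [laurent_at] expansion of order [N = m + 1] the coefficient of
   [(s - z0) ^ (-1)] has index [m]. *)
Definition is_residue (f : C -> C) (z0 c : C) : Prop :=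
  exists (m : nat) (a : nat -> C), laurent_at f z0 (S m) a /\ c = a m.

Definition residue (f : C -> C) (z0 : C) : C :=
  epsilon (inhabits (RtoC 0)) (is_residue f z0).

(* [Z] is the meromorphic continuation of [zeta(s; r, q)] to the complex plane.
   The values of [Z] at its poles are irrelevant. *)
Definition is_zeta_ap (r q : nat) (Z : C -> C) : Prop :=
  (forall z0 : C, meromorphic_at Z z0) /\
  (forall s : C, 1 < Re s ->
     is_series (K := C_AbsRing) (V := C_NormedModule)
       (fun m => if congr (S m) r q then Rcpower (INR (S m)) (- s)%C else RtoC 0)
       (Z s)).

Definition dstar (r1 q1 r2 q2 n : nat) : nat :=
  length (filter
    (fun p => (Nat.eqb (fst p * snd p) n && congr (fst p) r1 q1
               && congr (snd p) r2 q2)%bool)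
    (list_prod (seq 1 n) (seq 1 n))).

(* [Z1] and [Z2] stand for [zeta(.; r1, q1)] and [zeta(.; r2, q2)]; the residue
   is a real number for them, so that [Re] only changes its type. *)
Definition Delta2 (r1 q1 r2 q2 : nat) (Z1 Z2 : C -> C) (x : R) : R :=
  sum_upto (fun n => INR (dstar r1 q1 r2 q2 n)) x
  - Re (residue (fun s => (Z1 s * Z2 s * (Rcpower x s / s))%C) (RtoC 1)).

Definition gamma_EL (k r q : nat) : R :=
  real (Lim (fun x =>
    sum_upto_ap (fun n => ln (INR n) ^ k / INR n) r q x
    - ln x ^ (k + 1) / (INR q * INR (k + 1))) p_infty).

Definition I_main (k : nat) (x alpha : R) : R :=
  Rpower x (1 - alpha) *
  sum_n (fun i => (-1) ^ i * (INR (fact k) / INR (fact (k - i)))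
                  * (ln x ^ (k - i) / (1 - alpha) ^ (i + 1))) k.

Definition zeta_const (k : nat) (alpha : R) (r q : nat) : R :=
  real (Lim (fun x =>
    sum_upto_ap (fun n => ln (INR n) ^ k / Rpower (INR n) alpha) r q x
    - I_main k x alpha / INR q) p_infty).

(* [v] is the value of the convergent improper integral of [f] over [1, +oo). *)
Definition is_int_1_infty (f : R -> R) (v : R) : Prop :=
  is_RInt_gen (V := R_NormedModule) f (at_point 1) (Rbar_locally p_infty) v.

(* Main.v *)
(* Let N_i(y) count the n <= y with n = r_i mod q_i. The error e_i(y) = N_i(y) - y / q_i
   is bounded. The weight in the integral is -g'(x) with g(x) = log^k x / x^alpha, so by
   Abel summation the integral over [1, X] of the weight against sum_(n <= x) d_*(n) is the
   sum of g(ab) - g(X) over pairs ab <= X, that is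
     - sum_b 1_(r_2, q_2)(b) int_1^(X/b) N_1(v) w(bv) dv / v,     w(x) = x g'(x).
   The part v / q_1 of N_1 gives explicit sums over b. In the part e_1 the sum over b is
   moved inside the integral; w(bv) is a sum of products of powers of logarithms of b and of
   v, so the inner sums are those defining the constants, equal to main term + constant +
   O((X/v)^(-beta)) for every beta < alpha. Since e_1 is bounded, the total error is
   O(X^(-beta) log X). Hence the integral converges for every alpha > 0, and no bound on the
   divisor problem is used: integration has already averaged the error term.
   The residue is found from the Laurent expansions at 1, whose first two coefficients
   1 / q and gamma_0(r, q) are determined by letting s tend to 1 along s > 1. *)

(* The delicate terms carry the factor [Om X], where [Om] is an antiderivative of [w(x) = x g'(x)].
   It grows like a power of [ln X] for alpha = 1 and like [X ^ (1 - alpha)] times logarithms below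
   1, and it multiplies sums of [1 / b] and integrals of [e_1(u) / u ^ 2]. These belong to exponent
   1 whatever alpha is, which is why gamma_0 occurs in the second formula as well. Mere convergence
   to gamma_0 would not stand up to the growth of [Om]; what is used is the rate [X ^ (-b)] for
   every [b < 1]. The residue contains the same two gamma_0, so the growing terms cancel exactly.
   The two formulas are one computation. Of the subtracted main terms it uses only that [Phi j] is
   an antiderivative of [ln^j x / x^alpha] and that [Phi k x / x] is a linear combination of the
   functions [ln^l x / x^alpha] with [l <= k + 1]. On the complex side, meromorphy gives a Laurent
   expansion of unknown order and [residue] is picked by [epsilon]. A bound on the real axis limits
   the order, and uniqueness of Laurent coefficients identifies the choice. *)
Require Import Defs.
From Stdlib Require Import Reals ZArith Arith List Bool Lra Lia ClassicalEpsilon.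
From Coquelicot Require Import Coquelicot.
Open Scope R_scope.

(* Coquelicot types real sums by the carrier of [R_AbelianMonoid], which [ring] and
   [field] do not recognize as [R]; these tactics restore the type and abstract the
   sums. *)
Ltac eqR := lazymatch goal with |- @eq _ ?a ?b => change (@eq R a b) end.
Ltac gen_sums :=
  repeat match goal with
  | |- context [@sum_n_m _ ?f ?a ?b] =>
      let x := fresh "s" in pose (x := (@sum_n_m R_AbelianMonoid f a b : R));
      repeat match goal with
      | |- context [@sum_n_m ?G f a b] => change (@sum_n_m G f a b) with x
      end;
      clearbody x
  | |- context [@sum_n _ ?f ?a] =>
      let x := fresh "s" in pose (x := (@sum_n R_AbelianMonoid f a : R));
      repeat match goal with
      | |- context [@sum_n ?G f a] => change (@sum_n G f a) with x
      end;
      clearbody x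
  end.
Ltac rring := eqR; gen_sums; ring.

(** * Sums up to a real bound, and their integrals *)

Definition ustep (n : nat) (u : R) : R := if Rle_dec (INR n) u then 1 else 0.

Lemma sum_upto_S (f : nat -> R) (m : nat) :
  sum_n_m f 1 (S m) = sum_n_m f 1 m + f (S m).
Proof. rewrite sum_n_Sm; [ reflexivity | lia ]. Qed.

Lemma sum_upto_0 (f : nat -> R) : sum_n_m f 1 0 = 0.
Proof. rewrite sum_n_m_zero; [ reflexivity | lia ]. Qed.

Lemma nfloor_spec (u : R) :
  0 <= u -> INR (Z.to_nat (Int_part u)) <= u < INR (Z.to_nat (Int_part u)) + 1.
Proof.
  intros Hu. destruct (base_Int_part u) as [H1 H2].
  assert (0 <= Int_part u)%Z.
  { assert (-1 < Int_part u)%Z; [ | lia ]. apply lt_IZR. lra. }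
  rewrite INR_IZR_INZ, Z2Nat.id by assumption. lra.
Qed.

Lemma nfloor_INR (u : R) (m : nat) :
  INR m <= u < INR m + 1 -> Z.to_nat (Int_part u) = m.
Proof.
  intros H. assert (Hu : 0 <= u) by (pose proof (pos_INR m); lra).
  pose proof (nfloor_spec u Hu) as H1.
  assert (H2 : (Z.to_nat (Int_part u) < S m)%nat)
    by (apply INR_lt; rewrite S_INR; lra).
  assert (H3 : (m < S (Z.to_nat (Int_part u)))%nat)
    by (apply INR_lt; rewrite S_INR; lra).
  lia.
Qed.

(** Trades the moving upper limit for a factor: the range [1..m] no longer depends on [u], so the
    sum can be interchanged with an integral over [u] or with another sum. *)
Lemma sum_upto_ind (a : nat -> R) (u : R) (m : nat) :
  0 <= u < INR m + 1 -> sum_upto a u = sum_n_m (fun n => a n * ustep n u) 1 m.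
Proof.
  intros [Hu Hm]. unfold sum_upto.
  destruct (nfloor_spec u Hu) as [H1 H2].
  set (p := Z.to_nat (Int_part u)) in *.
  assert (Hpm : (p <= m)%nat).
  { assert (p < S m)%nat; [ | lia ]. apply INR_lt. rewrite S_INR. lra. }
  assert (Hmin : forall m, sum_n_m (fun n => a n * ustep n u) 1 m
                           = sum_n_m a 1 (Nat.min m p)).
  { induction m0 as [ | j IH ].
    - now rewrite !sum_upto_0.
    - rewrite sum_upto_S, IH. unfold ustep. destruct (Rle_dec (INR (S j)) u) as [Hj | Hj].
      + assert (S j < S p)%nat by (apply INR_lt; rewrite S_INR with (n := p); lra).
        rewrite (Nat.min_l (S j) p), (Nat.min_l j p), sum_upto_S by lia. rring.
      + assert (p < S j)%nat by (apply INR_lt; lra).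
        rewrite (Nat.min_r (S j) p), (Nat.min_r j p) by lia. rring. }
  rewrite Hmin, Nat.min_r by assumption. reflexivity.
Qed.

Lemma sum_upto_ext (a b : nat -> R) (u : R) :
  (forall n, (1 <= n)%nat -> INR n <= u -> a n = b n) -> sum_upto a u = sum_upto b u.
Proof.
  intros H. unfold sum_upto.
  destruct (Rle_lt_dec 0 u) as [Hu | Hu].
  - destruct (nfloor_spec u Hu) as [H1 H2].
    apply sum_n_m_ext_loc. intros n Hn. apply H; [ lia | ].
    apply Rle_trans with (2 := H1). apply le_INR. lia.
  - destruct (base_Int_part u) as [H1 H2].
    replace (Z.to_nat (Int_part u)) with 0%nat; [ now rewrite !sum_upto_0 | ].
    assert (Int_part u < 0)%Z by (apply lt_IZR; lra). lia.
Qed.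

Lemma sum_1_plus (f g : nat -> R) (m : nat) :
  sum_n_m (fun n => f n + g n) 1 m = sum_n_m f 1 m + sum_n_m g 1 m.
Proof. exact (sum_n_m_plus f g 1 m). Qed.

Lemma sum_1_scal (c : R) (f : nat -> R) (m : nat) :
  sum_n_m (fun n => c * f n) 1 m = c * sum_n_m f 1 m.
Proof. exact (sum_n_m_mult_l c f 1 m). Qed.

Lemma sum_1_minus (f g : nat -> R) (m : nat) :
  sum_n_m (fun n => f n - g n) 1 m = sum_n_m f 1 m - sum_n_m g 1 m.
Proof.
  induction m as [ | m IH ]; [ rewrite !sum_upto_0 | rewrite !sum_upto_S, IH ]; rring.
Qed.

Lemma sum_1_switch (f : nat -> nat -> R) (m p : nat) :
  sum_n_m (fun i => sum_n_m (fun j => f i j) 1 p) 1 m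
  = sum_n_m (fun j => sum_n_m (fun i => f i j) 1 m) 1 p.
Proof.
  induction m as [ | m IH ].
  - rewrite sum_upto_0. symmetry.
    transitivity (sum_n_m (G := R_AbelianMonoid) (fun _ => zero) 1 p).
    + apply sum_n_m_ext. intros n. apply sum_upto_0.
    + exact (sum_n_m_const_zero (G := R_AbelianMonoid) 1 p).
  - rewrite sum_upto_S, IH, <- sum_1_plus. apply sum_n_m_ext. intros n.
    now rewrite sum_upto_S.
Qed.

Lemma is_RInt_sum_1 (f : nat -> R -> R) (l : nat -> R) (a b : R) (m : nat) :
  (forall n, (1 <= n <= m)%nat -> is_RInt (f n) a b (l n)) ->
  is_RInt (fun u => sum_n_m (fun n => f n u) 1 m) a b (sum_n_m l 1 m).
Proof.
  induction m as [ | m IH ]; intros H.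
  - apply is_RInt_ext with (fun _ => 0).
    + intros. now rewrite sum_upto_0.
    + rewrite sum_upto_0. evar_last; [ apply (is_RInt_const a b (0 : R)) | ].
      unfold scal; simpl; unfold mult; simpl; rring.
  - apply is_RInt_ext with (fun u => plus (sum_n_m (fun n => f n u) 1 m) (f (S m) u)).
    + intros. now rewrite sum_upto_S.
    + rewrite sum_upto_S. apply (is_RInt_plus (V := R_NormedModule)).
      * apply IH. intros. apply H. lia.
      * apply H. lia.
Qed.

Lemma is_RInt_sum_0 (f : nat -> R -> R) (l : nat -> R) (a b : R) (m : nat) :
  (forall n, (n <= m)%nat -> is_RInt (f n) a b (l n)) ->
  is_RInt (fun u => sum_n (fun n => f n u) m) a b (sum_n l m).
Proof.
  induction m as [ | m IH ]; intros H.
  - rewrite sum_O. apply is_RInt_ext with (f 0%nat).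
    + intros. now rewrite sum_O.
    + apply H. lia.
  - rewrite sum_Sn.
    apply is_RInt_ext with (fun u => plus (sum_n (fun n => f n u) m) (f (S m) u)).
    + intros. now rewrite sum_Sn.
    + apply (is_RInt_plus (V := R_NormedModule)).
      * apply IH. intros. apply H. lia.
      * apply H. lia.
Qed.

Lemma is_RInt_eqv (f : R -> R) (a b l l' : R) :
  is_RInt f a b l -> l = l' -> is_RInt f a b l'.
Proof. now intros H <-. Qed.

Lemma is_RInt_FTC (F f : R -> R) (a b : R) :
  a <= b -> (forall u, a <= u <= b -> is_derive F u (f u)) ->
  (forall u, a <= u <= b -> continuous f u) ->
  is_RInt f a b (F b - F a).
Proof.
  intros Hab Hd Hc. apply (is_RInt_derive (V := R_CompleteNormedModule));
    rewrite Rmin_left, Rmax_right by assumption; assumption.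
Qed.

Lemma is_RInt_ind_ge (f : R -> R) (a b l : R) (n : nat) :
  a <= INR n <= b -> is_RInt f (INR n) b l ->
  is_RInt (fun u => f u * ustep n u) a b l.
Proof.
  intros H Hf. replace l with (plus (0 : R) l) by (unfold plus; simpl; ring).
  apply (is_RInt_Chasles (V := R_NormedModule)) with (b := INR n).
  - apply is_RInt_ext with (fun _ => 0).
    + rewrite Rmin_left, Rmax_right by lra. intros u Hu. unfold ustep.
      destruct (Rle_dec (INR n) u); [ lra | rring ].
    + eapply is_RInt_eqv; [ apply (is_RInt_const a (INR n) (0 : R)) | ].
      unfold scal; simpl; unfold mult; simpl; rring.
  - apply is_RInt_ext with f; [ | assumption ].
    rewrite Rmin_left, Rmax_right by lra. intros u Hu. unfold ustep.
    destruct (Rle_dec (INR n) u); [ rring | lra ].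
Qed.

(** The condition [n <= X / u] is [u <= X / n], so the factor cuts the integral off at [X / n]. *)
Lemma is_RInt_ind_le (f : R -> R) (a b l X : R) (n : nat) :
  (1 <= n)%nat -> 0 < a -> a <= X / INR n <= b -> is_RInt f a (X / INR n) l ->
  is_RInt (fun u => f u * ustep n (X / u)) a b l.
Proof.
  intros Hn Ha H Hf. replace l with (plus l (0 : R)) by (unfold plus; simpl; ring).
  assert (Hn' : 0 < INR n) by (apply lt_0_INR; lia).
  apply (is_RInt_Chasles (V := R_NormedModule)) with (b := X / INR n).
  - apply is_RInt_ext with f; [ | assumption ].
    rewrite Rmin_left, Rmax_right by lra. intros u Hu. unfold ustep.
    destruct (Rle_dec (INR n) (X / u)) as [Hle | Hle]; [ rring | exfalso ].
    apply Hle. apply Rle_div_r; [ lra | ]. rewrite Rmult_comm.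
    apply Rle_div_r; lra.
  - apply is_RInt_ext with (fun _ => 0).
    + rewrite Rmin_left, Rmax_right by lra. intros u Hu. unfold ustep.
      destruct (Rle_dec (INR n) (X / u)) as [Hle | Hle]; [ exfalso | rring ].
      apply Rle_div_r in Hle; [ | lra ]. rewrite Rmult_comm in Hle.
      apply Rle_div_r in Hle; lra.
    + eapply is_RInt_eqv; [ apply (is_RInt_const (X / INR n) b (0 : R)) | ].
      unfold scal; simpl; unfold mult; simpl; rring.
Qed.

(** The term of index [n] contributes only from [u = n] on, where the fundamental theorem gives
    [F X - F (INR n)]; these contributions are added up over [n]. *)
Lemma abel_summation (a : nat -> R) (F f : R -> R) (X : R) :
  1 <= X -> (forall u, 1 <= u <= X -> is_derive F u (f u)) ->
  (forall u, 1 <= u <= X -> continuous f u) ->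
  is_RInt (fun u => f u * sum_upto a u) 1 X
    (sum_upto (fun n => a n * (F X - F (INR n))) X).
Proof.
  intros HX Hd Hc. destruct (nfloor_spec X) as [H1 H2]; [ lra | ].
  set (m := Z.to_nat (Int_part X)) in *.
  apply is_RInt_ext with
    (fun u => sum_n_m (fun n => a n * (f u * ustep n u)) 1 m).
  - rewrite Rmin_left, Rmax_right by lra. intros u Hu.
    rewrite (sum_upto_ind a u m), <- sum_1_scal by lra.
    apply sum_n_m_ext. intros n. rring.
  - unfold sum_upto. fold m.
    apply is_RInt_sum_1 with (f := fun n u => a n * (f u * ustep n u)).
    intros n Hn.
    assert (1 <= INR n <= X).
    { split; [ apply (le_INR 1); lia | ].
      apply Rle_trans with (2 := H1). apply le_INR. lia. }
    apply (is_RInt_scal (V := R_NormedModule)).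
    apply is_RInt_ind_ge; [ lra | ].
    apply is_RInt_FTC; intros; [ lra | apply Hd | apply Hc ]; lra.
Qed.

(** * The counting function of a residue class *)

Definition ap_ind (r q n : nat) : R := if congr n r q then 1 else 0.

Definition ap_count (r q : nat) (x : R) : R := sum_upto (ap_ind r q) x.

Definition ap_err (r q : nat) (x : R) : R := ap_count r q x - x / INR q.

Lemma sum_upto_ap_ind (f : nat -> R) (r q : nat) (x : R) :
  sum_upto_ap f r q x = sum_upto (fun n => ap_ind r q n * f n) x.
Proof.
  apply sum_upto_ext. intros n _ _. unfold ap_ind. destruct (congr n r q); rring.
Qed.

Lemma div_S (n q : nat) :
  (1 <= q)%nat -> (S n / q = n / q + if S n mod q =? 0 then 1 else 0)%nat.
Proof.
  intros Hq.
  pose proof (Nat.div_mod n q ltac:(lia)) as E.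
  pose proof (Nat.mod_upper_bound n q ltac:(lia)) as L.
  destruct (Nat.eq_dec (S (n mod q)) q) as [Hs | Hs].
  - assert (E' : S n = (q * S (n / q) + 0)%nat) by nia.
    rewrite <- (Nat.mod_unique (S n) q (S (n / q)) 0) by (assumption || lia).
    rewrite <- (Nat.div_unique (S n) q (S (n / q)) 0) by (assumption || lia).
    simpl. lia.
  - assert (E' : S n = (q * (n / q) + S (n mod q))%nat) by nia.
    rewrite <- (Nat.mod_unique (S n) q (n / q) (S (n mod q))) by (assumption || lia).
    rewrite <- (Nat.div_unique (S n) q (n / q) (S (n mod q))) by (assumption || lia).
    simpl. lia.
Qed.

Lemma congr_sub (n r q : nat) :
  (1 <= r <= q)%nat -> congr n r q = ((n + q - r) mod q =? 0)%nat.
Proof.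
  intros Hr. unfold congr. apply eq_true_iff_eq. rewrite !Nat.eqb_eq.
  pose proof (Nat.div_mod n q ltac:(lia)) as E.
  pose proof (Nat.div_mod r q ltac:(lia)) as E'.
  assert (Hb : (r / q <= 1)%nat).
  { destruct (Nat.le_gt_cases (r / q) 1); [ assumption | nia ]. }
  split; intros H.
  - rewrite H in E.
    symmetry. apply (Nat.mod_unique _ _ (n / q + 1 - r / q)); [ lia | nia ].
  - apply Nat.Div0.mod_divides in H. destruct H as [c Hc].
    rewrite <- (Nat.Div0.mod_add n 1 q), <- (Nat.Div0.mod_add r c q).
    f_equal. nia.
Qed.

(** Both sides increase by one exactly when [q] divides [m + q - r]. At [m = 0] the quotient is [0]
    because [r >= 1]. *)
Lemma ap_count_nat (r q m : nat) :
  (1 <= r <= q)%nat -> sum_n_m (ap_ind r q) 1 m = INR ((m + q - r) / q).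
Proof.
  intros Hr. induction m as [ | m IH ].
  - rewrite sum_upto_0, Nat.div_small by lia. reflexivity.
  - rewrite sum_upto_S, IH. unfold ap_ind. rewrite congr_sub by assumption.
    replace (S m + q - r)%nat with (S (m + q - r)) by lia.
    rewrite div_S, plus_INR by lia. destruct (_ =? 0)%nat; reflexivity.
Qed.

(** The integer quotient in the count costs at most [1] and rounding [x] down costs at most [1 / q],
    hence the constant [2]. *)
Lemma ap_err_bound (r q : nat) (x : R) :
  (1 <= r <= q)%nat -> 0 <= x -> Rabs (ap_err r q x) <= 2.
Proof.
  intros Hr Hx. unfold ap_err, ap_count, sum_upto.
  destruct (nfloor_spec x Hx) as [H1 H2]. set (m := Z.to_nat (Int_part x)) in *.
  rewrite ap_count_nat by assumption.
  pose proof (Nat.div_mod (m + q - r) q ltac:(lia)) as E.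
  pose proof (Nat.mod_upper_bound (m + q - r) q ltac:(lia)) as L.
  set (d := ((m + q - r) / q)%nat) in *.
  assert (Hq : 1 <= INR q) by (apply (le_INR 1); lia).
  assert (E1 : (q * d <= m + q)%nat) by lia.
  assert (E2 : (m <= q * d + q)%nat) by lia.
  apply le_INR in E1, E2. rewrite !plus_INR, ?mult_INR in *.
  assert (Hx' : x = x / INR q * INR q) by (field; lra).
  set (y := x / INR q) in *.
  apply Rabs_le. split; nra.
Qed.

(** * The divisor sum as a double sum *)

Lemma INR_length_filter {A : Type} (p : A -> bool) (l : list A) :
  INR (length (filter p l)) = fold_right (fun a s => (if p a then 1 else 0) + s) 0 l.
Proof.
  induction l as [ | a l IH ]; [ reflexivity | ].
  cbn [filter fold_right]. destruct (p a); [ | rewrite <- IH; rring ].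
  cbn [length]. rewrite S_INR, IH. rring.
Qed.

Lemma fold_right_sum_app {A : Type} (f : A -> R) (l l' : list A) :
  fold_right (fun a s => f a + s) 0 (l ++ l')
  = fold_right (fun a s => f a + s) 0 l + fold_right (fun a s => f a + s) 0 l'.
Proof. induction l as [ | a l IH ]; simpl; [ | rewrite IH ]; rring. Qed.

Lemma fold_right_sum_seq (f : nat -> R) (m : nat) :
  fold_right (fun a s => f a + s) 0 (seq 1 m) = sum_n_m f 1 m.
Proof.
  induction m as [ | m IH ]; [ now rewrite sum_upto_0 | ].
  rewrite seq_S, fold_right_sum_app, IH, sum_upto_S. simpl. rring.
Qed.

Lemma fold_right_sum_prod {A B : Type} (f : A * B -> R) (l : list A) (l' : list B) :
  fold_right (fun p s => f p + s) 0 (list_prod l l')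
  = fold_right (fun a s => fold_right (fun b s => f (a, b) + s) 0 l' + s) 0 l.
Proof.
  induction l as [ | a l IH ]; [ reflexivity | ].
  simpl. rewrite fold_right_sum_app, IH. f_equal.
  clear. induction l' as [ | b l' IH ]; simpl; [ reflexivity | now rewrite IH ].
Qed.

Lemma sum_1_zero_tail (f : nat -> R) (n m : nat) :
  (n <= m)%nat -> (forall i, (n < i <= m)%nat -> f i = 0) ->
  sum_n_m f 1 n = sum_n_m f 1 m.
Proof.
  intros Hnm H. induction Hnm as [ | m Hnm IH ]; [ reflexivity | ].
  rewrite sum_upto_S, (H (S m)), IH by (lia || (intros; apply H; lia)). rring.
Qed.

Lemma sum_1_single (f : nat -> R) (c m : nat) :
  (forall i, i <> c -> f i = 0) ->
  sum_n_m f 1 m = if ((1 <=? c) && (c <=? m))%nat then f c else 0.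
Proof.
  intros H. induction m as [ | m IH ].
  - rewrite sum_upto_0. destruct c; reflexivity.
  - rewrite sum_upto_S, IH.
    destruct (Nat.eq_dec (S m) c) as [<- | Hc].
    + replace (S m <=? m)%nat with false by (symmetry; apply Nat.leb_gt; lia).
      rewrite Nat.leb_refl. simpl. rring.
    + rewrite (H (S m)) by assumption.
      replace (c <=? S m)%nat with (c <=? m)%nat.
      * destruct (_ && _); rring.
      * apply eq_true_iff_eq. rewrite !Nat.leb_le. lia.
Qed.

(** The factors range up to a common [m] instead of [n], so that a sum over [n] can be moved inside.
    The added pairs are harmless: both factors are positive, so a factor beyond [n] makes the
    product exceed [n]. *)
Lemma dstar_sum (r1 q1 r2 q2 n m : nat) :
  (1 <= n <= m)%nat ->
  INR (dstar r1 q1 r2 q2 n)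
  = sum_n_m (fun b => sum_n_m (fun a =>
      ap_ind r2 q2 b * ap_ind r1 q1 a * if (a * b =? n)%nat then 1 else 0) 1 m) 1 m.
Proof.
  intros Hn. unfold dstar.
  rewrite INR_length_filter, fold_right_sum_prod.
  rewrite fold_right_sum_seq.
  rewrite <- (sum_1_switch (fun a b =>
      ap_ind r2 q2 b * ap_ind r1 q1 a * if (a * b =? n)%nat then 1 else 0)).
  transitivity (sum_n_m (fun a => sum_n_m (fun b =>
      ap_ind r2 q2 b * ap_ind r1 q1 a * if (a * b =? n)%nat then 1 else 0) 1 m) 1 n).
  - apply sum_n_m_ext_loc. intros a Ha.
    rewrite fold_right_sum_seq.
    rewrite <- sum_1_zero_tail with (n := n) (m := m).
    + apply sum_n_m_ext. intros b. simpl. unfold ap_ind.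
      destruct (_ =? n)%nat, (congr a r1 q1), (congr b r2 q2); simpl; rring.
    + lia.
    + intros b Hb. destruct (Nat.eqb_spec (a * b) n); [ nia | rring ].
  - apply sum_1_zero_tail; [ lia | ]. intros a Ha.
    transitivity (sum_n_m (G := R_AbelianMonoid) (fun _ => zero) 1 m).
    + apply sum_n_m_ext_loc. intros b Hb.
      destruct (Nat.eqb_spec (a * b) n); [ nia | ]. unfold zero; simpl. rring.
    + exact (sum_n_m_const_zero (G := R_AbelianMonoid) 1 m).
Qed.

(** With fixed ranges the sum over [n] can be done first: it has one nonzero term, at [n = a * b],
    and leaves the condition [a * b <= m]. *)
Lemma sum_upto_dstar (r1 q1 r2 q2 : nat) (F : nat -> R) (X : R) :
  0 <= X ->
  sum_upto (fun n => INR (dstar r1 q1 r2 q2 n) * F n) X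
  = sum_upto (fun b => ap_ind r2 q2 b
      * sum_upto (fun a => ap_ind r1 q1 a * F (a * b)%nat) (X / INR b)) X.
Proof.
  intros HX. destruct (nfloor_spec X HX) as [H1 H2].
  unfold sum_upto at 1 2. set (m := Z.to_nat (Int_part X)) in *.
  transitivity (sum_n_m (fun n => sum_n_m (fun b => sum_n_m (fun a =>
      ap_ind r2 q2 b * ap_ind r1 q1 a * (if (a * b =? n)%nat then F n else 0))
      1 m) 1 m) 1 m).
  - apply sum_n_m_ext_loc. intros n Hn.
    rewrite (dstar_sum _ _ _ _ n m), Rmult_comm, <- sum_1_scal by assumption.
    apply sum_n_m_ext. intros b. rewrite <- sum_1_scal.
    apply sum_n_m_ext. intros a. destruct (_ =? _)%nat; rring.
  - rewrite (sum_1_switch (fun n b => sum_n_m _ 1 m)).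
    apply sum_n_m_ext_loc. intros b Hb.
    rewrite (sum_1_switch (fun n a => _)).
    assert (Hb' : 1 <= INR b) by (apply (le_INR 1); lia).
    rewrite (sum_upto_ind _ _ m), <- sum_1_scal.
    + apply sum_n_m_ext_loc. intros a Ha. rewrite (sum_1_single _ (a * b)).
      * rewrite Nat.eqb_refl. unfold ustep.
        replace (1 <=? a * b)%nat with true by (symmetry; apply Nat.leb_le; nia).
        (* As [a * b] is an integer, comparing it with [m], the integer part of [X], is the same as
           comparing [a] with [X / b]. *)
        cbn [andb]. destruct (Nat.leb_spec (a * b) m) as [L | L];
          destruct (Rle_dec (INR a) (X / INR b)) as [D | D]; [ rring | exfalso | exfalso | rring ].
        -- apply D. apply Rle_div_r; [ lra | ]. rewrite <- mult_INR.
           apply Rle_trans with (2 := H1). now apply le_INR.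
        -- apply Rle_div_r in D; [ | lra ]. rewrite <- mult_INR in D.
           apply Nat.le_succ_l, le_INR in L. rewrite S_INR in L. lra.
      * intros n Hn. destruct (Nat.eqb_spec (a * b) n); [ congruence | rring ].
    + split; [ apply Rdiv_le_0_compat; lra | ].
      apply Rlt_div_l; [ lra | ]. pose proof (pos_INR m). nra.
Qed.

(** * Powers of the logarithm times a power of [x] *)

Definition logpow (a : R) (j : nat) (x : R) : R := ln x ^ j * Rpower x (- a).

(* [logpow' a j] is [x * d/dx] applied to [logpow a j]. *)
Definition logpow' (a : R) (j : nat) (x : R) : R :=
  (INR j * ln x ^ (j - 1) - a * ln x ^ j) * Rpower x (- a).

Lemma is_derive_Rpower (c x : R) :
  0 < x -> is_derive (fun y => Rpower y c) x (c * Rpower x c / x).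
Proof.
  intros Hx. unfold Rpower. auto_derive; [ assumption | ]. field. lra.
Qed.

Lemma is_derive_logpow (a : R) (j : nat) (x : R) :
  0 < x -> is_derive (logpow a j) x (logpow' a j x / x).
Proof.
  intros Hx. unfold logpow, logpow', Rpower. auto_derive; [ repeat split; assumption | ].
  replace (Init.Nat.pred j) with (j - 1)%nat by lia.
  (* For [j = 0] the truncated exponent [j - 1] is harmless, since its factor [INR j] vanishes. *)
  destruct j; [ simpl; field; lra | ].
  replace (S j - 1)%nat with j by lia. simpl pow. field. lra.
Qed.

Lemma continuous_of_derive (f : R -> R) (x l : R) : is_derive f x l -> continuous f x.
Proof. intros H. apply (ex_derive_continuous (V := R_NormedModule)). now exists l. Qed.

Lemma continuous_ln (x : R) : 0 < x -> continuous ln x.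
Proof. intros Hx. apply continuous_of_derive with (/ x). now apply is_derive_ln. Qed.

Lemma continuous_pow (f : R -> R) (n : nat) (x : R) :
  continuous f x -> continuous (fun y => f y ^ n) x.
Proof.
  intros Hf. induction n as [ | n IH ].
  - apply continuous_const.
  - simpl. now apply (continuous_mult f (fun y => f y ^ n)).
Qed.

Lemma continuous_logpow' (a : R) (j : nat) (x : R) : 0 < x -> continuous (logpow' a j) x.
Proof.
  intros Hx. unfold logpow'.
  apply (continuous_mult (fun y => INR j * ln y ^ (j - 1) - a * ln y ^ j)).
  - apply (continuous_minus (fun y => INR j * ln y ^ (j - 1))).
    + apply (continuous_mult (fun _ => INR j)); [ apply continuous_const | ].
      now apply continuous_pow, continuous_ln.
    + apply (continuous_mult (fun _ => a)); [ apply continuous_const | ].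
      now apply continuous_pow, continuous_ln.
  - now apply continuous_of_derive with (1 := is_derive_Rpower (- a) x Hx).
Qed.

Lemma ln_nonneg (x : R) : 1 <= x -> 0 <= ln x.
Proof. intros Hx. rewrite <- ln_1. apply ln_le; lra. Qed.

Lemma Rpower_pos (x c : R) : 0 < Rpower x c.
Proof. apply exp_pos. Qed.

Lemma Rpower_le1 (x c : R) : 1 <= x -> 0 <= c -> Rpower x (- c) <= 1.
Proof.
  intros Hx Hc. unfold Rpower. rewrite <- exp_0. pose proof (ln_nonneg x Hx).
  destruct (Req_dec (- c * ln x) 0) as [-> | Hn]; [ lra | ].
  left. apply exp_increasing. nra.
Qed.

Lemma Rpower_decreasing (x b c : R) : 1 <= x -> b <= c -> Rpower x (- c) <= Rpower x (- b).
Proof.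
  intros Hx Hbc. replace (- c) with (- b + - (c - b)) by ring. rewrite Rpower_plus.
  pose proof (Rpower_pos x (- b)). pose proof (Rpower_le1 x (c - b) Hx ltac:(lra)). nra.
Qed.

(** The gap [a - b] pays for the logarithms: [e * ln x <= exp (e * ln x)] bounds each factor [ln x]
    by [x ^ e / e]. *)
Lemma logpow_bound (a b : R) (j : nat) :
  b < a -> exists C, 0 <= C /\ forall x, 1 <= x -> Rabs (logpow a j x) <= C * Rpower x (- b).
Proof.
  (* Dividing by [j + 1] rather than [j] covers [j = 0]; the [j] factors then use at most [a - b] of
     the exponent. *)
  intros Hab. set (e := (a - b) / (INR j + 1)).
  pose proof (pos_INR j) as Hj.
  assert (He : 0 < e) by (apply Rdiv_lt_0_compat; lra).
  exists ((/ e) ^ j). split; [ apply pow_le; left; now apply Rinv_0_lt_compat | ].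
  intros x Hx. pose proof (ln_nonneg x Hx) as Hl.
  unfold logpow. rewrite Rabs_mult, (Rabs_right (Rpower _ _)), Rabs_right
    by (apply Rle_ge; [ apply pow_le; lra ] || (left; apply Rpower_pos)).
  assert (H1 : ln x <= / e * Rpower x e).
  { apply Rmult_le_reg_l with e; [ assumption | ].
    replace (e * (/ e * Rpower x e)) with (Rpower x e) by (field; lra).
    unfold Rpower. pose proof (exp_ineq1_le (e * ln x)). lra. }
  assert (H2 : ln x ^ j <= (/ e) ^ j * Rpower x (e * INR j)).
  { apply Rle_trans with ((/ e * Rpower x e) ^ j).
    - apply pow_incr. lra.
    - rewrite Rpow_mult_distr. right. f_equal.
      rewrite <- Rpower_pow by apply Rpower_pos. now rewrite Rpower_mult. }
  assert (H3 : Rpower x (e * INR j) * Rpower x (- a) <= Rpower x (- b)).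
  { rewrite <- Rpower_plus.
    replace (e * INR j + - a) with (- (a - e * INR j)) by ring.
    apply Rpower_decreasing; [ assumption | ].
    assert (e * (INR j + 1) = a - b) by (unfold e; field; lra). nra. }
  pose proof (Rpower_pos x (- a)).
  assert (0 <= (/ e) ^ j) by (apply pow_le; left; now apply Rinv_0_lt_compat).
  apply Rle_trans with ((/ e) ^ j * Rpower x (e * INR j) * Rpower x (- a)); nra.
Qed.

Lemma logpow'_eq (a : R) (j : nat) (x : R) :
  logpow' a j x = INR j * logpow a (j - 1) x - a * logpow a j x.
Proof. unfold logpow', logpow. ring. Qed.

Lemma logpow'_bound (a b : R) (j : nat) :
  b < a -> exists C, 0 <= C /\ forall x, 1 <= x -> Rabs (logpow' a j x) <= C * Rpower x (- b).
Proof.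
  intros Hab. destruct (logpow_bound a b (j - 1) Hab) as [C1 [HC1 H1]].
  destruct (logpow_bound a b j Hab) as [C2 [HC2 H2]].
  pose proof (pos_INR j) as Hj. pose proof (Rabs_pos a) as Ha.
  exists (INR j * C1 + Rabs a * C2). split; [ nra | ].
  intros x Hx. rewrite logpow'_eq. specialize (H1 x Hx). specialize (H2 x Hx).
  eapply Rle_trans; [ apply Rabs_triang | ].
  rewrite Rabs_Ropp, !Rabs_mult, (Rabs_right (INR j)) by lra.
  rewrite Rmult_plus_distr_r, !Rmult_assoc.
  apply Rplus_le_compat; apply Rmult_le_compat_l; assumption.
Qed.

(** * Tail integrals and limits with a power rate *)

Lemma Rpower_small (b eps : R) :
  0 < b -> 0 < eps -> exists M, 1 <= M /\ forall x, M <= x -> Rpower x (- b) < eps.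
Proof.
  intros Hb He. exists (exp (Rabs (ln eps) / b + 1)).
  assert (H0 : 0 <= Rabs (ln eps) / b) by (apply Rdiv_le_0_compat; [ apply Rabs_pos | lra ]).
  split.
  - left. rewrite <- exp_0 at 1. apply exp_increasing. lra.
  - intros x Hx. unfold Rpower. rewrite <- (exp_ln eps He). apply exp_increasing.
    assert (H1 : Rabs (ln eps) / b + 1 <= ln x).
    { rewrite <- (ln_exp (Rabs (ln eps) / b + 1)). apply ln_le; [ apply exp_pos | assumption ]. }
    assert (H2 : b * (Rabs (ln eps) / b) = Rabs (ln eps)) by (field; lra).
    pose proof (Rabs_maj2 (ln eps)). nra.
Qed.

Lemma is_RInt_Rpower_tail (C b Y Y' : R) :
  0 < b -> 0 < Y <= Y' ->
  is_RInt (fun u => C * Rpower u (- b - 1)) Y Y'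
    (C / b * (Rpower Y (- b) - Rpower Y' (- b))).
Proof.
  intros Hb HY. eapply is_RInt_eqv.
  - apply (is_RInt_FTC (fun u => - C / b * Rpower u (- b))); [ lra | | ].
    + intros u Hu. eapply is_derive_ext_loc; [ apply filter_forall; reflexivity | ].
      evar_last.
      * apply (is_derive_scal (fun u => Rpower u (- b))), is_derive_Rpower. lra.
      * replace (- b - 1) with (- b + - (1)) by ring.
        rewrite Rpower_plus, (Rpower_Ropp u 1), Rpower_1 by lra. unfold scal; simpl; unfold mult; simpl. field. lra.
    + intros u Hu. apply (continuous_mult (fun _ => C)); [ apply continuous_const | ].
      eapply continuous_of_derive. apply is_derive_Rpower. lra.
  - simpl. field. lra.
Qed.

(** The integral from [Y] to [Y'] is at most that of the majorant, which is below [C / b * Y ^ (-b)]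
    uniformly in [Y']. This gives the Cauchy property, and letting [Y'] grow gives the rate. *)
Lemma integral_tail (f : R -> R) (C b : R) :
  0 < b -> (forall Y, 1 <= Y -> ex_RInt f 1 Y) ->
  (forall u, 1 <= u -> Rabs (f u) <= C * Rpower u (- b - 1)) ->
  exists J, forall Y, 1 <= Y -> Rabs (RInt f 1 Y - J) <= C / b * Rpower Y (- b).
Proof.
  intros Hb Hex Hf.
  assert (HC : 0 <= C).
  { pose proof (Hf 1 (Rle_refl 1)) as H. pose proof (Rabs_pos (f 1)).
    pose proof (Rpower_pos 1 (- b - 1)). nra. }
  assert (HCb : 0 <= C / b) by (apply Rdiv_le_0_compat; lra).
  assert (Hd : forall Y Y', 1 <= Y <= Y' ->
      Rabs (RInt f 1 Y' - RInt f 1 Y) <= C / b * Rpower Y (- b)).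
  { intros Y Y' HY.
    assert (Hx : is_RInt f Y Y' (RInt f 1 Y' - RInt f 1 Y)).
    { replace (RInt f 1 Y' - RInt f 1 Y) with (plus (opp (RInt f 1 Y)) (RInt f 1 Y'))
        by (unfold plus, opp; simpl; ring).
      apply (is_RInt_Chasles (V := R_NormedModule)) with (b := 1).
      - apply (is_RInt_swap (V := R_NormedModule)), (RInt_correct (V := R_CompleteNormedModule)), Hex. lra.
      - apply (RInt_correct (V := R_CompleteNormedModule)), Hex. lra. }
    apply Rle_trans with (C / b * (Rpower Y (- b) - Rpower Y' (- b))).
    - apply (norm_RInt_le (V := R_NormedModule) f (fun u => C * Rpower u (- b - 1)) Y Y').
      + lra.
      + intros u Hu. apply Hf. lra.
      + assumption.
      + apply is_RInt_Rpower_tail; lra.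
    - pose proof (Rpower_pos Y' (- b)). nra. }
  destruct (ex_lim_seq_cauchy_corr (fun n => RInt f 1 (INR n + 1))) as [H _].
  (* The limit is taken along the points [n + 1] only, all of them in [[1, oo)]; [Hd] later compares
     it with an arbitrary real [Y]. *)
  assert (Hlim : ex_finite_lim_seq (fun n => RInt f 1 (INR n + 1))).
  { apply ex_lim_seq_cauchy_corr. intros eps.
    destruct (Rpower_small b (eps / (C / b + 1))) as [M [HM HM']]; [ assumption | | ].
    { apply Rdiv_lt_0_compat; [ apply cond_pos | lra ]. }
    assert (Hn0 : exists N, M <= INR N).
    { exists (Z.to_nat (up M)). rewrite INR_IZR_INZ.
      destruct (archimed M). rewrite Z2Nat.id; [ lra | ]. apply le_IZR. lra. }
    destruct Hn0 as [N HN]. exists N.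
    assert (Hs : forall n m, (N <= n)%nat -> (n <= m)%nat ->
        Rabs (RInt f 1 (INR m + 1) - RInt f 1 (INR n + 1)) < eps).
    { intros n m Hn Hm. apply le_INR in Hn, Hm.
      eapply Rle_lt_trans; [ apply Hd; pose proof (pos_INR n); lra | ].
      specialize (HM' (INR n + 1) ltac:(lra)).
      pose proof (Rpower_pos (INR n + 1) (- b)).
      apply Rlt_div_r in HM'; [ | lra ]. nra. }
    intros n m Hn Hm. destruct (Nat.le_ge_cases n m).
    - rewrite Rabs_minus_sym. now apply Hs.
    - now apply Hs. }
  clear H. destruct Hlim as [J HJ]. exists J. intros Y HY.
  rewrite Rabs_minus_sym.
  apply (is_lim_seq_le_loc (fun n => Rabs (RInt f 1 (INR n + 1) - RInt f 1 Y))
    (fun _ => C / b * Rpower Y (- b)) (Rabs (J - RInt f 1 Y)) (C / b * Rpower Y (- b))).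
  - exists (Z.to_nat (up Y)). intros n Hn. apply Hd. split; [ assumption | ].
    apply le_INR in Hn. rewrite INR_IZR_INZ, Z2Nat.id in Hn;
      [ destruct (archimed Y); lra | ].
    destruct (archimed Y). apply le_IZR. lra.
  - apply (is_lim_seq_abs _ (Finite (J - RInt f 1 Y))).
    apply is_lim_seq_minus'; [ assumption | apply is_lim_seq_const ].
  - apply is_lim_seq_const.
Qed.

(** Splitting [ap_err] into the count and [u / q] leaves one sum, by Abel summation, and one
    integral that is explicit because [H] is an antiderivative of [f u * u]. *)
Lemma ap_err_integral (r q : nat) (F H f : R -> R) (X : R) :
  1 <= X ->
  (forall u, 1 <= u <= X -> is_derive F u (f u)) ->
  (forall u, 1 <= u <= X -> continuous f u) ->
  (forall u, 1 <= u <= X -> is_derive H u (f u * u)) ->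
  is_RInt (fun u => f u * ap_err r q u) 1 X
    (sum_upto (fun n => ap_ind r q n * (F X - F (INR n))) X - (H X - H 1) / INR q).
Proof.
  intros HX HF Hf HH.
  apply is_RInt_ext with
    (fun u => minus (f u * sum_upto (ap_ind r q) u) (scal (/ INR q) (f u * u))).
  - intros u _. unfold ap_err, ap_count, minus, plus, opp, scal; simpl; unfold mult; simpl.
    unfold Rdiv. rring.
  - eapply is_RInt_eqv.
    + apply (is_RInt_minus (V := R_NormedModule)).
      * apply abel_summation with (F := F); assumption.
      * apply (is_RInt_scal (V := R_NormedModule)), is_RInt_FTC with (F := H);
          [ assumption | assumption | ].
        intros u Hu. apply (continuous_mult f); [ now apply Hf | apply continuous_id ].
    + unfold minus, plus, opp, scal; simpl; unfold mult; simpl. unfold Rdiv. rring.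
Qed.

Lemma is_lim_of_rate (f : R -> R) (l C b : R) :
  0 < b -> (forall x, 1 <= x -> Rabs (f x - l) <= C * Rpower x (- b)) ->
  is_lim f p_infty l.
Proof.
  intros Hb Hf. apply is_lim_spec. intros eps.
  assert (HC : 0 <= C).
  { pose proof (Hf 1 (Rle_refl 1)) as H. pose proof (Rabs_pos (f 1 - l)).
    pose proof (Rpower_pos 1 (- b)). nra. }
  destruct (Rpower_small b (eps / (C + 1))) as [M [HM HM']]; [ assumption | | ].
  { apply Rdiv_lt_0_compat; [ apply cond_pos | lra ]. }
  exists M. intros x Hx. eapply Rle_lt_trans; [ apply Hf; lra | ].
  specialize (HM' x ltac:(lra)). apply Rlt_div_r in HM'; [ | lra ].
  pose proof (Rpower_pos x (- b)). nra.
Qed.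

(** * Sums over a residue class and their constants *)

Definition ap_logsum (a : R) (j r q : nat) (x : R) : R :=
  sum_upto (fun n => ap_ind r q n * logpow a j (INR n)) x.

(** Common form of [gamma_EL] and [zeta_const]. The value depends on the additive constant in the
    antiderivative [Phi], so [Phi] is a parameter. *)
Definition ap_const (a : R) (j r q : nat) (Phi : R -> R) : R :=
  real (Lim (fun x => ap_logsum a j r q x - Phi x / INR q) p_infty).

(** Integration by parts: [x * logpow a j x - Phi x] is an antiderivative of [x] times the
    derivative of [logpow a j]. *)
Lemma ap_logsum_eq (a : R) (j r q : nat) (Phi : R -> R) (Y : R) :
  1 <= Y -> (forall x, 0 < x -> is_derive Phi x (logpow a j x)) ->
  is_RInt (fun u => logpow' a j u / u * ap_err r q u) 1 Y
    (logpow a j Y * ap_err r q Y + (Phi Y + logpow a j 1 - Phi 1) / INR q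
     - ap_logsum a j r q Y).
Proof.
  intros HY HPhi. eapply is_RInt_eqv.
  - apply (ap_err_integral r q (logpow a j) (fun x => x * logpow a j x - Phi x)
      (fun u => logpow' a j u / u)); [ assumption | | | ].
    + intros u Hu. apply is_derive_logpow. lra.
    + intros u Hu. apply (continuous_mult (logpow' a j)).
      * apply continuous_logpow'. lra.
      * apply continuous_Rinv. lra.
    + intros u Hu. evar_last.
      * apply (is_derive_minus (fun x => x * logpow a j x)); [ | apply HPhi; lra ].
        apply (is_derive_mult (fun x : R => x)); [ apply is_derive_id
          | apply is_derive_logpow; lra | intros; apply Rmult_comm ].
      * unfold minus, plus, opp, mult, one; simpl. field. lra.
  - unfold ap_err, ap_count, ap_logsum, sum_upto, Rdiv.
    set (m := Z.to_nat (Int_part Y)).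
    assert (E : sum_n_m (fun n => ap_ind r q n * (logpow a j Y - logpow a j (INR n))) 1 m
      = logpow a j Y * sum_n_m (ap_ind r q) 1 m
        - sum_n_m (fun n => ap_ind r q n * logpow a j (INR n)) 1 m).
    { rewrite <- sum_1_scal, <- sum_1_minus. apply sum_n_m_ext. intros n. rring. }
    rewrite E. rring.
Qed.

(** The error of the count is bounded and [logpow' a j u] is [O(u ^ (-b))], so the integral in
    [ap_logsum_eq] converges with rate [Y ^ (-b)]. The same identity then links its limit to the
    constant of the sum; later steps need both the sum and the integral. *)
Lemma ap_logsum_asymp (a : R) (j r q : nat) (Phi : R -> R) (b : R) :
  (1 <= r <= q)%nat -> 0 < b < a ->
  (forall x, 0 < x -> is_derive Phi x (logpow a j x)) ->
  exists C, 0 <= C /\ forall Y, 1 <= Y ->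
    Rabs (ap_logsum a j r q Y - Phi Y / INR q - ap_const a j r q Phi)
      <= C * Rpower Y (- b) /\
    Rabs (RInt (fun u => logpow' a j u / u * ap_err r q u) 1 Y
          - ((logpow a j 1 - Phi 1) / INR q - ap_const a j r q Phi))
      <= C * Rpower Y (- b).
Proof.
  intros Hr Hb HPhi.
  destruct (logpow_bound a b j) as [C1 [HC1 H1]]; [ lra | ].
  destruct (logpow'_bound a b j) as [C2 [HC2 H2]]; [ lra | ].
  destruct (integral_tail (fun u => logpow' a j u / u * ap_err r q u) (2 * C2) b)
    as [J HJ]; [ lra | | | ].
  - intros Y HY. eexists. now apply (ap_logsum_eq a j r q Phi).
  - intros u Hu. rewrite Rabs_mult. unfold Rdiv. rewrite Rabs_mult.
    rewrite (Rabs_right (/ u)) by (left; apply Rinv_0_lt_compat; lra).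
    replace (- b - 1) with (- b + - (1)) by ring.
    rewrite Rpower_plus, (Rpower_Ropp u 1), Rpower_1 by lra.
    pose proof (ap_err_bound r q u Hr ltac:(lra)) as He. specialize (H2 u Hu).
    pose proof (Rabs_pos (ap_err r q u)). pose proof (Rabs_pos (logpow' a j u)).
    assert (0 < / u) by (apply Rinv_0_lt_compat; lra).
    apply Rle_trans with ((C2 * Rpower u (- b) * / u) * 2); [ | right; ring ].
    apply Rmult_le_compat; [ nra | assumption | nra | assumption ].
  - set (K := 2 * C2 / b) in *.
    assert (HK : 0 <= K) by (apply Rdiv_le_0_compat; lra).
    assert (Hs : forall Y, 1 <= Y ->
      Rabs (ap_logsum a j r q Y - Phi Y / INR q - ((logpow a j 1 - Phi 1) / INR q - J))
      <= (2 * C1 + K) * Rpower Y (- b)).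
    { intros Y HY. specialize (HJ Y HY). specialize (H1 Y HY).
      rewrite (is_RInt_unique _ _ _ _ (ap_logsum_eq a j r q Phi Y HY HPhi)) in HJ.
      replace (ap_logsum a j r q Y - Phi Y / INR q - ((logpow a j 1 - Phi 1) / INR q - J))
        with (logpow a j Y * ap_err r q Y
          - (logpow a j Y * ap_err r q Y + (Phi Y + logpow a j 1 - Phi 1) / INR q
             - ap_logsum a j r q Y - J)) by (unfold Rdiv; ring).
      eapply Rle_trans; [ apply Rabs_triang | ]. rewrite Rabs_Ropp, Rabs_mult.
      pose proof (ap_err_bound r q Y Hr ltac:(lra)) as He.
      pose proof (Rabs_pos (ap_err r q Y)). pose proof (Rabs_pos (logpow a j Y)).
      pose proof (Rpower_pos Y (- b)).
      assert (Rabs (logpow a j Y) * Rabs (ap_err r q Y) <= C1 * Rpower Y (- b) * 2)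
        by (apply Rmult_le_compat; assumption).
      lra. }
    (* [ap_const] is defined by [Lim], which has a value in any case; the rate [Hs] shows that the
       limit exists and is this number. *)
    assert (HZ : ap_const a j r q Phi = (logpow a j 1 - Phi 1) / INR q - J).
    { unfold ap_const.
      erewrite is_lim_unique; [ | eapply is_lim_of_rate with (b := b); [ lra | apply Hs ] ].
      reflexivity. }
    rewrite HZ. exists (2 * C1 + K). split; [ lra | ]. intros Y HY. split.
    + now apply Hs.
    + replace ((logpow a j 1 - Phi 1) / INR q - ((logpow a j 1 - Phi 1) / INR q - J))
        with J by ring.
      eapply Rle_trans; [ now apply HJ | ]. pose proof (Rpower_pos Y (- b)). nra.
Qed.

Lemma logpow_nat_inv (a : R) (j n : nat) :
  logpow a j (INR n) = ln (INR n) ^ j / Rpower (INR n) a.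
Proof. unfold logpow, Rdiv. now rewrite Rpower_Ropp. Qed.

Lemma gamma_EL_ap_const (k r q : nat) :
  gamma_EL k r q = ap_const 1 k r q (fun x => ln x ^ (k + 1) / INR (k + 1)).
Proof.
  unfold gamma_EL, ap_const. f_equal. apply Lim_ext. intros x. f_equal.
  - rewrite sum_upto_ap_ind. apply sum_upto_ext. intros n Hn _.
    rewrite logpow_nat_inv, Rpower_1; [ reflexivity | apply lt_0_INR; lia ].
  - unfold Rdiv. rewrite Rinv_mult. ring.
Qed.

Lemma zeta_const_ap_const (k : nat) (a : R) (r q : nat) :
  zeta_const k a r q = ap_const a k r q (fun x => I_main k x a).
Proof.
  unfold zeta_const, ap_const. f_equal. apply Lim_ext. intros x. f_equal.
  rewrite sum_upto_ap_ind. apply sum_upto_ext. intros n Hn _.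
  now rewrite logpow_nat_inv.
Qed.

(** * Complex power series on a punctured disc, with the exponential and geometric series *)

Notation is_Cseries := (is_series (K := C_AbsRing) (V := C_NormedModule)).

Lemma C_eq (z w : C) : Re z = Re w -> Im z = Im w -> z = w.
Proof. destruct z, w. simpl. now intros -> ->. Qed.

Lemma Re_sum_n (a : nat -> C) (n : nat) :
  Re (sum_n (G := C_AbelianMonoid) a n) = sum_n (fun k => Re (a k)) n.
Proof.
  induction n as [ | n IH ]; [ now rewrite !sum_O | ].
  rewrite !sum_Sn. unfold plus at 2. simpl. now rewrite <- IH.
Qed.

Lemma Im_sum_n (a : nat -> C) (n : nat) :
  Im (sum_n (G := C_AbelianMonoid) a n) = sum_n (fun k => Im (a k)) n.
Proof.
  induction n as [ | n IH ]; [ now rewrite !sum_O | ].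
  rewrite !sum_Sn. unfold plus at 2. simpl. now rewrite <- IH.
Qed.

Lemma is_Cseries_iff (a : nat -> C) (l : C) :
  is_Cseries a l <->
  is_series (fun k => Re (a k)) (Re l) /\ is_series (fun k => Im (a k)) (Im l).
Proof.
  unfold is_series. split.
  - intros H. pose proof (proj1 (filterlim_locally _ _) H) as H'. clear H.
    split; apply (filterlim_locally (U := R_UniformSpace)); intros eps;
      generalize (H' eps); apply filter_imp; intros n [H1 H2].
    + rewrite <- Re_sum_n. exact H1.
    + rewrite <- Im_sum_n. exact H2.
  - intros [H1 H2]. apply (filterlim_locally (U := C_UniformSpace)). intros eps.
    pose proof (proj1 (filterlim_locally (U := R_UniformSpace) _ _) H1 eps) as H1'.
    pose proof (proj1 (filterlim_locally (U := R_UniformSpace) _ _) H2 eps) as H2'.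
    generalize (filter_and _ _ H1' H2'). apply filter_imp. intros n [H3 H4].
    rewrite <- Re_sum_n in H3. rewrite <- Im_sum_n in H4. split; assumption.
Qed.

Lemma pow_n_Cpow (w : C) (n : nat) : pow_n (K := C_Ring) w n = Cpow w n.
Proof. induction n as [ | n IH ]; [ reflexivity | ]. simpl. now rewrite IH. Qed.

(** [is_pseries] with its generic power and scalar product replaced by [Cpow] and [Cmult], on which
    [ring] and [field] work. *)
Definition is_Cpseries (a : nat -> C) (w l : C) : Prop :=
  is_Cseries (fun n => (Cpow w n * a n)%C) l.

Lemma is_pseries_Cpseries (a : nat -> C) (w l : C) :
  is_pseries (K := C_AbsRing) (V := C_NormedModule) a w l <-> is_Cpseries a w l.
Proof.
  unfold is_pseries, is_Cpseries. split; apply is_series_ext; intros n;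
    rewrite <- (pow_n_Cpow w n); reflexivity.
Qed.

(* [F] is given on the punctured disc of radius [d] at [0] by the power series [a]. *)
Definition expands (a : nat -> C) (F : C -> C) (d : R) : Prop :=
  forall w : C, 0 < Cmod w < d -> is_Cpseries a w (F w).

Lemma Cmod_le_Rabs (z : C) : Cmod z <= Rabs (Re z) + Rabs (Im z).
Proof.
  replace z with ((Re z, 0) + (0, Im z))%C at 1
    by (apply C_eq; simpl; ring).
  eapply Rle_trans; [ apply Cmod_triangle | ]. unfold Cmod. simpl.
  rewrite !Rmult_1_r, !Rmult_0_l, Rplus_0_r, Rplus_0_l.
  change (Re z * Re z) with (Rsqr (Re z)). change (Im z * Im z) with (Rsqr (Im z)).
  rewrite !sqrt_Rsqr_abs. lra.
Qed.

Lemma im_le_Cmod (z : C) : Rabs (Im z) <= Cmod z.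
Proof. eapply Rle_trans; [ apply Rmax_r | apply Rmax_Cmod ]. Qed.

(** Convergence at [rho] makes the terms tend to [0] there, so [rho] is not outside the disc of
    convergence and [r < rho] is strictly inside. *)
Lemma Rpseries_abs_inside (u : nat -> R) (r rho l : R) :
  0 <= r < rho -> is_series (fun n => rho ^ n * u n) l ->
  ex_series (fun n => Rabs (u n) * r ^ n).
Proof.
  intros Hr Hs.
  apply ex_series_ext with (fun n => Rabs (u n * r ^ n)).
  { intros n. rewrite Rabs_mult, (Rabs_right (r ^ n)); [ reflexivity | ].
    apply Rle_ge, pow_le. lra. }
  apply CV_disk_inside. rewrite Rabs_right by lra.
  destruct (Rbar_lt_le_dec r (CV_radius u)) as [ | Hle ]; [ assumption | exfalso ].
  apply (CV_disk_outside u rho).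
  - eapply Rbar_le_lt_trans; [ apply Hle | ]. simpl. rewrite Rabs_right; lra.
  - apply is_lim_seq_ext with (fun n => rho ^ n * u n); [ intros; ring | ].
    apply ex_series_lim_0. now exists l.
Qed.

Lemma Cmod_RtoC_pos (t : R) : 0 <= t -> Cmod (RtoC t) = t.
Proof. intros Ht. rewrite Cmod_R. apply Rabs_right. lra. Qed.

(** At a real point [rho] between [r] and [d] the powers are real, so the complex series splits into
    two real power series, to which the theory of the radius of convergence applies. *)
Lemma expands_abs (a : nat -> C) (F : C -> C) (d r : R) :
  expands a F d -> 0 <= r < d -> ex_series (fun n => Cmod (a n) * r ^ n).
Proof.
  intros Ha Hr. set (rho := (r + d) / 2).
  assert (Hrho : 0 < Cmod (RtoC rho) < d)
    by (rewrite Cmod_RtoC_pos by (unfold rho; lra); unfold rho; lra).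
  specialize (Ha _ Hrho). apply is_Cseries_iff in Ha. destruct Ha as [H1 H2].
  assert (E : forall n, (RtoC rho ^ n * a n)%C
      = (rho ^ n * Re (a n), rho ^ n * Im (a n))).
  { intros n. rewrite <- RtoC_pow. apply C_eq; unfold Re, Im, Cmult, RtoC; simpl; ring. }
  assert (H1' : is_series (fun n => rho ^ n * Re (a n)) (Re (F rho))).
  { revert H1. apply is_series_ext. intros n. now rewrite E. }
  assert (H2' : is_series (fun n => rho ^ n * Im (a n)) (Im (F rho))).
  { revert H2. apply is_series_ext. intros n. now rewrite E. }
  apply Rpseries_abs_inside with (r := r) in H1'; [ | unfold rho; lra ].
  apply Rpseries_abs_inside with (r := r) in H2'; [ | unfold rho; lra ].
  apply (ex_series_le (V := R_CompleteNormedModule)) with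
    (b := fun n => Rabs (Re (a n)) * r ^ n + Rabs (Im (a n)) * r ^ n).
  - intros n. unfold norm; simpl; unfold abs; simpl.
    assert (0 <= r ^ n) by (apply pow_le; lra).
    pose proof (Cmod_ge_0 (a n)). pose proof (Cmod_le_Rabs (a n)).
    rewrite Rabs_right by nra. nra.
  - apply (ex_series_plus (V := R_NormedModule)); assumption.
Qed.

Lemma Cpseries_bounded (a : nat -> C) (r : R) :
  0 <= r -> ex_series (fun n => Cmod (a n) * r ^ n) ->
  exists B, forall w l, Cmod w <= r -> is_Cpseries a w l -> Cmod l <= B.
Proof.
  intros Hr Hex. set (B := Series (fun n => Cmod (a n) * r ^ n)).
  (* [B] bounds the real and the imaginary part separately. *)
  exists (2 * B). intros w l Hw Hl. apply is_Cseries_iff in Hl. destruct Hl as [H1 H2].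
  assert (Hb : forall u : nat -> R, (forall n, Rabs (u n) <= Cmod (Cpow w n * a n)%C) ->
      Rabs (Series u) <= B).
  { intros u Hu.
    assert (Hu' : forall n, 0 <= Rabs (u n) <= Cmod (a n) * r ^ n).
    { intros n. split; [ apply Rabs_pos | ]. eapply Rle_trans; [ apply Hu | ].
      rewrite Cmod_mult, Cmod_pow, Rmult_comm. apply Rmult_le_compat_l.
      - apply Cmod_ge_0.
      - apply pow_incr. split; [ apply Cmod_ge_0 | assumption ]. }
    eapply Rle_trans.
    - apply Series_Rabs.
      apply (ex_series_le (V := R_CompleteNormedModule)) with (2 := Hex).
      intros n. unfold norm; simpl; unfold abs; simpl. rewrite Rabs_Rabsolu. apply Hu'.
    - apply Series_le; assumption. }
  pose proof (Hb _ (fun n => re_le_Cmod _)) as B1.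
  pose proof (Hb _ (fun n => im_le_Cmod _)) as B2.
  rewrite (is_series_unique _ _ H1) in B1. rewrite (is_series_unique _ _ H2) in B2.
  pose proof (Cmod_le_Rabs l). lra.
Qed.

Lemma Cmod_pos_neq (w : C) : 0 < Cmod w -> w <> RtoC 0.
Proof. intros H. now apply Cmod_gt_0. Qed.

Lemma expands_ext (a b : nat -> C) (F G : C -> C) (d : R) :
  (forall n, a n = b n) -> (forall w, 0 < Cmod w < d -> F w = G w) ->
  expands a F d -> expands b G d.
Proof.
  intros Hab HFG H w Hw. rewrite <- HFG by assumption.
  generalize (H w Hw). apply is_series_ext. intros n. now rewrite Hab.
Qed.

(** Makes each coefficient the zeroth one of another function, so that statements about coefficients
    reduce to index [0]. *)
Lemma expands_tail (a : nat -> C) (F : C -> C) (d : R) :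
  expands a F d -> expands (fun n => a (S n)) (fun w => ((F w - a O) / w)%C) d.
Proof.
  intros H w Hw. specialize (H w Hw). pose proof (Cmod_pos_neq w (proj1 Hw)) as Hn.
  apply is_pseries_Cpseries in H. apply is_pseries_Cpseries.
  assert (E : (/ w * w)%C = RtoC 1) by (field; assumption).
  pose proof (is_pseries_decr_1 (K := C_AbsRing) (V := C_NormedModule) a w (/ w)%C (F w) E H)
    as H'.
  replace ((F w - a O) / w)%C with (/ w * (F w - a O))%C by (unfold Cdiv; ring).
  exact H'.
Qed.

Lemma expands_shift (a : nat -> C) (F : C -> C) (d : R) :
  expands a F d ->
  expands (fun n => match n with O => RtoC 0 | S p => a p end) (fun w => (w * F w)%C) d.
Proof.
  intros H w Hw. specialize (H w Hw).
  apply is_pseries_Cpseries in H. apply is_pseries_Cpseries.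
  exact (is_pseries_incr_1 (K := C_AbsRing) (V := C_NormedModule) a w (F w) H).
Qed.

(** The difference quotient is again given by a power series, hence bounded on half the disc. *)
Lemma expands_rate (a : nat -> C) (F : C -> C) (d : R) :
  0 < d -> expands a F d ->
  exists K, forall t, 0 < t < d / 2 -> Cmod (F (RtoC t) - a O)%C <= K * t.
Proof.
  intros Hd H. pose proof (expands_tail a F d H) as H'.
  destruct (Cpseries_bounded (fun n => a (S n)) (d / 2)) as [B HB].
  - lra.
  - apply expands_abs with (1 := H'). lra.
  - exists B. intros t Ht.
    assert (Hm : Cmod (RtoC t) = t) by (apply Cmod_RtoC_pos; lra).
    specialize (HB (RtoC t) ((F (RtoC t) - a O) / RtoC t)%C ltac:(lra)).
    rewrite Cmod_div, Hm in HB by (apply Cmod_pos_neq; lra).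
    apply Rle_div_l; [ lra | ]. apply HB. apply H'. lra.
Qed.

Lemma Cmod_small_eq (z : C) (K d : R) :
  0 < d -> (forall t, 0 < t < d -> Cmod z <= K * t) -> z = RtoC 0.
Proof.
  intros Hd H. apply Cmod_eq_0. apply Rle_antisym; [ | apply Cmod_ge_0 ].
  apply Rnot_lt_le. intros Hz.
  set (t := Rmin (d / 2) (Cmod z / (2 * (Rabs K + 1)))).
  pose proof (Rabs_pos K).
  assert (H1 : 0 < t).
  { apply Rmin_pos; [ lra | ]. apply Rdiv_lt_0_compat; lra. }
  assert (H2 : t <= d / 2) by apply Rmin_l.
  assert (H3 : t <= Cmod z / (2 * (Rabs K + 1))) by apply Rmin_r.
  apply Rle_div_r in H3; [ | lra ].
  specialize (H t ltac:(lra)). pose proof (Rle_abs K). nra.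
Qed.

(** The zeroth coefficient is read off along real [t > 0] alone, which is where the zeta function is
    known through its series. *)
Lemma expands_limit (a : nat -> C) (F : C -> C) (d e K : R) (l : C) :
  0 < d -> 0 < e -> expands a F d ->
  (forall t, 0 < t < e -> Cmod (F (RtoC t) - l)%C <= K * t) -> a O = l.
Proof.
  intros Hd He H Hl. destruct (expands_rate a F d Hd H) as [K' HK'].
  assert (E : (a O - l)%C = RtoC 0).
  { apply (Cmod_small_eq _ (K' + K) (Rmin (d / 2) e)).
    - apply Rmin_pos; lra.
    - intros t [Ht1 Ht2]. pose proof (Rmin_l (d / 2) e). pose proof (Rmin_r (d / 2) e).
      specialize (HK' t ltac:(lra)). specialize (Hl t ltac:(lra)).
      replace (a O - l)%C with (- (F (RtoC t) - a O) + (F (RtoC t) - l))%C by ring.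
      eapply Rle_trans; [ apply Cmod_triangle | ]. rewrite Cmod_opp. lra. }
  replace (a O) with ((a O - l) + l)%C by ring. rewrite E. ring.
Qed.

Lemma expands_zero (n : nat) : forall (a : nat -> C) (F : C -> C) (d : R),
  0 < d -> expands a F d -> (forall w, 0 < Cmod w < d -> F w = RtoC 0) -> a n = RtoC 0.
Proof.
  induction n as [ | n IH ]; intros a F d Hd H HF;
    assert (Ha : a O = RtoC 0)
      by (apply expands_limit with (F := F) (d := d) (e := d) (K := 0); try assumption;
          intros t Ht; rewrite HF by (rewrite Cmod_RtoC_pos; lra);
          replace (RtoC 0 - RtoC 0)%C with (RtoC 0) by ring; rewrite Cmod_0; lra).
  - exact Ha.
  - apply (IH (fun n => a (S n)) _ d Hd (expands_tail a F d H)).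
    intros w Hw. rewrite HF, Ha by assumption. field. now apply Cmod_pos_neq.
Qed.

Lemma is_Cseries_minus (a b : nat -> C) (la lb : C) :
  is_Cseries a la -> is_Cseries b lb ->
  is_Cseries (fun n => (a n - b n)%C) (la - lb)%C.
Proof. intros Ha Hb. exact (is_series_minus a b la lb Ha Hb). Qed.

Lemma is_Cseries_scal (c : C) (a : nat -> C) (l : C) :
  is_Cseries a l -> is_Cseries (fun n => (c * a n)%C) (c * l)%C.
Proof. intros Ha. exact (is_series_scal (K := C_AbsRing) c a l Ha). Qed.

Lemma expands_minus (a b : nat -> C) (F G : C -> C) (d : R) :
  expands a F d -> expands b G d ->
  expands (fun n => (a n - b n)%C) (fun w => (F w - G w)%C) d.
Proof.
  intros Ha Hb w Hw. generalize (is_Cseries_minus _ _ _ _ (Ha w Hw) (Hb w Hw)).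
  apply is_series_ext. intros n. simpl. ring.
Qed.

Lemma expands_subset (a : nat -> C) (F : C -> C) (d e : R) :
  e <= d -> expands a F d -> expands a F e.
Proof. intros Hed H w Hw. apply H. lra. Qed.

Definition shift_coef (N : nat) (a : nat -> C) (n : nat) : C :=
  if (n <? N)%nat then RtoC 0 else a (n - N)%nat.

Lemma expands_shiftn (N : nat) (a : nat -> C) (F : C -> C) (d : R) :
  expands a F d -> expands (shift_coef N a) (fun w => (Cpow w N * F w)%C) d.
Proof.
  intros H. induction N as [ | N IH ].
  - generalize H. apply expands_ext.
    + intros n. unfold shift_coef. simpl. f_equal. lia.
    + intros w _. simpl. ring.
  - generalize (expands_shift _ _ _ IH). apply expands_ext.
    + intros [ | n ]; unfold shift_coef; [ reflexivity | ].
      change (S n <? S N)%nat with (n <? N)%nat. reflexivity.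
    + intros w _. simpl. ring.
Qed.

(** Multiplying the expansions by [w ^ N'] and [w ^ N] makes them expand the same function. The
    condition on the indices says that [a n] and [a' n'] belong to the same power of [w] in [f]. *)
Lemma expands_unique (N N' n n' : nat) (a a' : nat -> C) (f : C -> C) (d d' : R) :
  0 < d -> 0 < d' ->
  expands a (fun w => (Cpow w N * f w)%C) d ->
  expands a' (fun w => (Cpow w N' * f w)%C) d' ->
  (n + N' = n' + N)%nat -> a n = a' n'.
Proof.
  intros Hd Hd' Ha Ha' Hn.
  apply (expands_shiftn N'), (expands_subset _ _ _ _ (Rmin_l d d')) in Ha.
  apply (expands_shiftn N), (expands_subset _ _ _ _ (Rmin_r d d')) in Ha'.
  pose proof (expands_minus _ _ _ _ _ Ha Ha') as H.
  apply expands_zero with (n := (n + N')%nat) in H.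
  - unfold shift_coef in H.
    replace (n + N' <? N')%nat with false in H by (symmetry; apply Nat.ltb_ge; lia).
    replace (n + N' <? N)%nat with false in H by (symmetry; apply Nat.ltb_ge; lia).
    replace (n + N' - N')%nat with n in H by lia.
    replace (n + N' - N)%nat with n' in H by lia.
    replace (a n) with ((a n - a' n') + a' n')%C by ring. rewrite H. ring.
  - now apply Rmin_pos.
  - intros w _. ring.
Qed.

Definition conv (a b : nat -> C) (n : nat) : C :=
  sum_n (G := C_AbelianMonoid) (fun k => (a k * b (n - k)%nat)%C) n.

(** Real and imaginary parts are combinations of four Cauchy products of absolutely convergent real
    series. *)
Lemma is_Cseries_mult (a b : nat -> C) (la lb : C) :
  is_Cseries a la -> is_Cseries b lb ->
  ex_series (fun n => Cmod (a n)) -> ex_series (fun n => Cmod (b n)) ->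
  is_Cseries (conv a b) (la * lb)%C.
Proof.
  intros Ha Hb Ea Eb. apply is_Cseries_iff in Ha, Hb.
  destruct Ha as [Ra Ia], Hb as [Rb Ib].
  assert (HR : forall u : nat -> C, ex_series (fun n => Cmod (u n)) ->
      ex_series (fun n => Rabs (Re (u n))) /\ ex_series (fun n => Rabs (Im (u n)))).
  { intros u Hu. split; apply (ex_series_le (V := R_CompleteNormedModule)) with (2 := Hu);
      intros n; unfold norm; simpl; unfold abs; simpl; rewrite Rabs_Rabsolu;
      [ apply re_le_Cmod | apply im_le_Cmod ]. }
  destruct (HR a Ea) as [ERa EIa]. destruct (HR b Eb) as [ERb EIb]. clear HR.
  apply is_Cseries_iff. split.
  - pose proof (is_series_minus _ _ _ _
      (is_series_mult _ _ _ _ Ra Rb ERa ERb) (is_series_mult _ _ _ _ Ia Ib EIa EIb)) as H.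
    replace (Re (la * lb)%C) with (plus (Re la * Re lb) (opp (Im la * Im lb)))
      by (unfold Re, Im, plus, opp; simpl; ring).
    revert H. apply is_series_ext. intros n. unfold conv. rewrite Re_sum_n.
    rewrite sum_n_Reals. unfold plus, opp; simpl.
    change (?x + - ?y) with (x - y). rewrite <- minus_sum. reflexivity.
  - pose proof (is_series_plus _ _ _ _
      (is_series_mult _ _ _ _ Ra Ib ERa EIb) (is_series_mult _ _ _ _ Ia Rb EIa ERb)) as H.
    replace (Im (la * lb)%C) with (plus (Re la * Im lb) (Im la * Re lb))
      by (unfold Re, Im, plus; simpl; ring).
    revert H. apply is_series_ext. intros n. unfold conv. rewrite Im_sum_n.
    rewrite sum_n_Reals. unfold plus; simpl. rewrite <- plus_sum. reflexivity.
Qed.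

Lemma expands_mult (a b : nat -> C) (F G : C -> C) (d : R) :
  expands a F d -> expands b G d ->
  expands (conv a b) (fun w => (F w * G w)%C) d.
Proof.
  intros Ha Hb w Hw.
  assert (Hr : 0 <= Cmod w < d) by lra.
  assert (E : forall (u : nat -> C) H, expands u H d ->
      ex_series (fun n => Cmod (Cpow w n * u n)%C)).
  { intros u H Hu. apply ex_series_ext with (2 := expands_abs u H d (Cmod w) Hu Hr).
    intros n. rewrite Cmod_mult, Cmod_pow. apply Rmult_comm. }
  generalize (is_Cseries_mult _ _ _ _ (Ha w Hw) (Hb w Hw) (E a F Ha) (E b G Hb)).
  apply is_series_ext. intros n. unfold conv.
  change (Cpow w n * ?x)%C with (scal (K := C_Ring) (V := C_ModuleSpace) (Cpow w n) x).
  unfold sum_n.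
  rewrite <- (sum_n_m_scal_l (K := C_Ring) (V := C_ModuleSpace) (Cpow w n)).
  apply sum_n_m_ext_loc. intros k Hk. unfold scal; simpl. unfold mult; simpl.
  replace n with (k + (n - k))%nat at 3 by lia. rewrite Cpow_add_r. ring.
Qed.

(* The real part of [c * Cexp (t * z)]; it is real-differentiable in [t], and
   differentiating replaces [c] by [c * z]. *)
Definition Re_exp (z c : C) (t : R) : R :=
  exp (t * Re z) * (Re c * cos (t * Im z) - Im c * sin (t * Im z)).

Lemma is_derive_Re_exp (z c : C) (t : R) :
  is_derive (Re_exp z c) t (Re_exp z (c * z)%C t).
Proof.
  unfold Re_exp. auto_derive; [ trivial | ].
  destruct z as [x y], c as [u v]. unfold Re, Im. simpl. ring.
Qed.

Lemma is_derive_n_Re_exp (z c : C) (n : nat) (t : R) :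
  is_derive_n (Re_exp z c) n t (Re_exp z (c * Cpow z n)%C t).
Proof.
  revert t. induction n as [ | n IH ]; intros t.
  - simpl. f_equal. ring.
  - simpl. apply is_derive_ext with (Re_exp z (c * Cpow z n)%C).
    + intros s. symmetry. apply is_derive_n_unique. apply IH.
    + replace (c * (z * Cpow z n))%C with (c * Cpow z n * z)%C by ring.
      apply is_derive_Re_exp.
Qed.

Lemma Re_exp_bound (z c : C) (t : R) :
  0 <= t <= 1 -> Rabs (Re_exp z c t) <= exp (Rabs (Re z)) * (2 * Cmod c).
Proof.
  intros Ht. unfold Re_exp. rewrite Rabs_mult.
  rewrite (Rabs_right (exp _)) by (left; apply exp_pos).
  apply Rmult_le_compat; [ left; apply exp_pos | apply Rabs_pos | | ].
  - assert (t * Re z <= Rabs (Re z)).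
    { pose proof (Rle_abs (Re z)). pose proof (Rabs_pos (Re z)). nra. }
    destruct (Req_dec (t * Re z) (Rabs (Re z))) as [-> | ]; [ lra | ].
    left. apply exp_increasing. lra.
  - pose proof (re_le_Cmod c) as H1. pose proof (im_le_Cmod c) as H2.
    pose proof (COS_bound (t * Im z)). pose proof (SIN_bound (t * Im z)).
    assert (Hb : forall u v B, Rabs u <= B -> -1 <= v <= 1 -> Rabs (u * v) <= B).
    { intros u v B Hu Hv. rewrite Rabs_mult.
      assert (Rabs v <= 1) by (apply Rabs_le; lra).
      pose proof (Rabs_pos u). pose proof (Rabs_pos v). nra. }
    eapply Rle_trans; [ apply Rabs_triang | ]. rewrite Rabs_Ropp.
    pose proof (Hb _ (cos (t * Im z)) _ H1 ltac:(lra)).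
    pose proof (Hb _ (sin (t * Im z)) _ H2 ltac:(lra)). lra.
Qed.

(** Taylor's formula in the real variable [t], between [0] and [1]: the derivatives at [0] are the
    real parts of [c * z ^ n], and the remainder is [O(|z| ^ (n + 1) / (n + 1)!)]. *)
Lemma Re_exp_series (z c : C) :
  is_series (fun n => Re (c * Cpow z n)%C / INR (fact n)) (Re_exp z c 1).
Proof.
  assert (H0 : is_lim_seq (fun n => Re_exp z c 1
      - sum_n (fun n => Re (c * Cpow z n)%C / INR (fact n)) n) 0).
  { apply is_lim_seq_abs_0.
    apply is_lim_seq_le_le with (u := fun _ => 0)
      (w := fun n => exp (Rabs (Re z)) * (2 * Cmod c)
                     * (Cmod z ^ S n / INR (fact (S n)))).
    - intros n. split; [ apply Rabs_pos | ].
      destruct (Taylor_Lagrange (Re_exp z c) n 0 1) as [zeta [Hz HT]].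
      + lra.
      + intros t _ [ | k ] _; simpl; [ trivial | ].
        eexists. exact (is_derive_n_Re_exp z c (S k) t).
      + rewrite HT, sum_n_Reals.
        rewrite (is_derive_n_unique _ _ _ _ (is_derive_n_Re_exp z c (S n) zeta)).
        match goal with |- Rabs (?s + ?r - ?s') <= _ => replace (s + r - s') with r end.
        * replace (1 - 0) with 1 by ring. rewrite pow1, Rabs_mult.
          assert (Hf : 0 < / INR (fact (S n))) by apply Rinv_0_lt_compat, INR_fact_lt_0.
          unfold Rdiv at 1. rewrite Rmult_1_l, (Rabs_right (/ _)) by lra.
          pose proof (Re_exp_bound z (c * Cpow z (S n))%C zeta ltac:(lra)) as Hb.
          rewrite Cmod_mult, Cmod_pow in Hb. unfold Rdiv.
          replace (exp (Rabs (Re z)) * (2 * Cmod c) * (Cmod z ^ S n * / INR (fact (S n))))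
            with (/ INR (fact (S n)) * (exp (Rabs (Re z)) * (2 * (Cmod c * Cmod z ^ S n))))
            by ring.
          apply Rmult_le_compat_l; [ lra | exact Hb ].
        * match goal with |- ?r = ?s + ?r - ?s' => cut (s = s'); [ intros ->; ring | ] end.
          apply sum_eq. intros k _.
          rewrite (is_derive_n_unique _ _ _ _ (is_derive_n_Re_exp z c k 0)).
          replace (1 - 0) with 1 by ring. rewrite pow1. unfold Re_exp.
          rewrite !Rmult_0_l, exp_0, cos_0, sin_0. unfold Rdiv. ring.
    - apply is_lim_seq_const.
    - replace (Finite 0) with (Rbar_mult (exp (Rabs (Re z)) * (2 * Cmod c)) 0)
        by (simpl; f_equal; ring).
      apply is_lim_seq_scal_l.
      apply (is_lim_seq_incr_1 (fun n => Cmod z ^ n / INR (fact n))).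
      apply is_lim_seq_Reals, cv_speed_pow_fact. }
  unfold is_series.
  change (is_lim_seq (sum_n (fun n => Re (c * Cpow z n)%C / INR (fact n)))
    (Re_exp z c 1)).
  apply is_lim_seq_ext with (fun n => Re_exp z c 1
    - (Re_exp z c 1 - sum_n (fun n => Re (c * Cpow z n)%C / INR (fact n)) n)).
  - intros n. rring.
  - replace (Finite (Re_exp z c 1)) with (Finite (Re_exp z c 1 - 0))
      by (f_equal; ring).
    apply is_lim_seq_minus'; [ apply is_lim_seq_const | exact H0 ].
Qed.

Lemma Cexp_series (z : C) :
  is_Cseries (fun n => (Cpow z n * RtoC (/ INR (fact n)))%C) (Cexp z).
Proof.
  apply is_Cseries_iff. split.
  - generalize (Re_exp_series z (RtoC 1)).
    replace (Re_exp z (RtoC 1) 1) with (Re (Cexp z)).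
    + apply is_series_ext. intros n. unfold Rdiv, Re. simpl. ring.
    + unfold Re_exp, Cexp, Re, Im. simpl. rewrite !Rmult_1_l. ring.
  (* The imaginary part of a number is the real part of [-i] times it. *)
  - generalize (Re_exp_series z (0, -1)).
    replace (Re_exp z (0, -1) 1) with (Im (Cexp z)).
    + apply is_series_ext. intros n. unfold Rdiv, Re, Im. simpl. ring.
    + unfold Re_exp, Cexp, Re, Im. simpl. rewrite !Rmult_1_l. ring.
Qed.

Lemma Rcpower_expands (x d : R) :
  0 < x ->
  expands (fun n => RtoC (x * ln x ^ n / INR (fact n)))
    (fun w => Rcpower x (RtoC 1 + w)%C) d.
Proof.
  intros Hx w _. unfold is_Cpseries.
  replace (Rcpower x (RtoC 1 + w)%C) with (RtoC x * Cexp (RtoC (ln x) * w)%C)%C.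
  - generalize (is_Cseries_scal (RtoC x) _ _ (Cexp_series (RtoC (ln x) * w)%C)).
    apply is_series_ext. intros n.
    rewrite Cpow_mult_l, <- RtoC_pow. unfold Rdiv. rewrite !RtoC_mult.
    lazymatch goal with |- @eq _ ?a ?b => change (@eq C a b) end. ring.
  - unfold Rcpower, Cexp. destruct w as [u v]. apply C_eq; unfold Re, Im; simpl.
    + replace (ln x * (1 + u) - 0 * (0 + v)) with (ln x + (ln x * u - 0 * v)) by ring.
      rewrite exp_plus, exp_ln by assumption.
      replace (ln x * (0 + v) + 0 * (1 + u)) with (ln x * v + 0 * u) by ring. ring.
    + replace (ln x * (1 + u) - 0 * (0 + v)) with (ln x + (ln x * u - 0 * v)) by ring.
      rewrite exp_plus, exp_ln by assumption.
      replace (ln x * (0 + v) + 0 * (1 + u)) with (ln x * v + 0 * u) by ring. ring.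
Qed.

Lemma Cgeom_neq (w : C) : Cmod w < 1 -> (RtoC 1 + w)%C <> RtoC 0.
Proof.
  intros Hw H. assert (E : w = (- (1))%C).
  { replace w with ((RtoC 1 + w) - RtoC 1)%C by ring. rewrite H. ring. }
  rewrite E, Cmod_m1 in Hw. lra.
Qed.

Lemma inv_expands : expands (fun n => RtoC ((-1) ^ n)) (fun w => (/ (RtoC 1 + w))%C) 1.
Proof.
  intros w Hw. pose proof (Cgeom_neq w (proj2 Hw)) as Hn.
  assert (Hs : forall n,
    sum_n (G := C_AbelianMonoid) (fun n => (Cpow w n * RtoC ((-1) ^ n))%C) n
    = ((RtoC 1 - Cpow (- w) (S n)) / (RtoC 1 + w))%C).
  { induction n as [ | n IH ].
    - rewrite sum_O. simpl. field. assumption.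
    - rewrite sum_Sn, IH. change (plus ?a ?b) with (Cplus a b).
      assert (E : (Cpow w (S n) * RtoC ((-1) ^ S n))%C = Cpow (- w)%C (S n)).
      { replace (- w)%C with (w * RtoC (-1))%C.
        - now rewrite Cpow_mult_l, RtoC_pow.
        - apply C_eq; simpl; ring. }
      rewrite E.
      rewrite (Cpow_S _ (S n)).
      lazymatch goal with |- @eq _ ?a ?b => change (@eq C a b) end. field. assumption. }
  unfold is_Cpseries, is_series.
  apply (filterlim_locally (U := C_UniformSpace)). intros eps.
  assert (H1 : is_lim_seq (fun n => Cmod w ^ n) 0).
  { apply is_lim_seq_geom. rewrite Rabs_right; [ lra | apply Rle_ge, Cmod_ge_0 ]. }
  apply is_lim_seq_incr_1 in H1. apply is_lim_seq_spec in H1.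
  assert (Hm : 0 < Cmod (RtoC 1 + w)%C) by now apply Cmod_gt_0.
  assert (He : 0 < eps * Cmod (RtoC 1 + w)%C) by (apply Rmult_lt_0_compat; [ apply cond_pos | assumption ]).
  generalize (H1 (mkposreal _ He)). apply filter_imp. intros n Hlt. simpl in Hlt.
  apply C_NormedModule_mixin_compat1.
  rewrite Hs. unfold minus, plus, opp; simpl.
  replace ((RtoC 1 - - w * Cpow (- w) n) / (RtoC 1 + w) + - / (RtoC 1 + w))%C
    with ((- Cpow (- w) (S n)) / (RtoC 1 + w))%C by (simpl; field; assumption).
  rewrite Cmod_div, Cmod_opp, Cmod_pow, Cmod_opp by assumption.
  apply Rlt_div_l; [ assumption | ].
  rewrite Rminus_0_r in Hlt. apply Rabs_lt_between in Hlt. simpl. lra.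
Qed.

(** * The zeta function of a residue class near 1 *)

Lemma is_derive_ln_pow (k : nat) (x : R) :
  0 < x -> is_derive (fun y => ln y ^ (k + 1) / INR (k + 1)) x (logpow 1 k x).
Proof.
  intros Hx. rewrite Nat.add_1_r.
  assert (INR (S k) <> 0) by (apply not_0_INR; lia).
  unfold logpow. rewrite Rpower_Ropp, Rpower_1 by assumption.
  auto_derive; [ assumption | ]. change (match k with 0%nat => 1 | S _ => INR k + 1 end) with (INR (S k)).
  field. split; assumption || lra.
Qed.

Lemma is_lim_upto_series (u : nat -> R) (l V : R) :
  is_lim (fun x => sum_upto u x) p_infty l -> is_series (fun m => u (S m)) V -> V = l.
Proof.
  intros Hl Hs.
  assert (H1 : is_lim_seq (fun n => sum_upto u (INR n)) l).
  { apply (is_lim_comp_seq (fun x => sum_upto u x) INR p_infty l Hl).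
    - exists 0%nat. discriminate.
    - apply is_lim_seq_INR. }
  apply is_lim_seq_incr_1 in H1.
  assert (H2 : is_lim_seq (fun n => sum_upto u (INR (S n))) V).
  { apply is_lim_seq_ext with (sum_n (fun m => u (S m))); [ | exact Hs ].
    intros n. unfold sum_upto. rewrite (nfloor_INR _ (S n)) by lra.
    induction n as [ | n IH ].
    - rewrite sum_O, sum_n_n. reflexivity.
    - rewrite sum_Sn, IH, (sum_upto_S u (S n)). reflexivity. }
  apply is_lim_seq_unique in H1, H2. rewrite H1 in H2. now inversion H2.
Qed.

(** By [ap_logsum_asymp], [V - / (INR q * t)] and [gamma_EL 0 r q] are both [/ INR q] minus an
    integral of the error of the count, with exponents [1 + t] and [1]. The two weights differ by
    [O(t)] times an integrable function. *)
Lemma zeta_real_rate (r q : nat) :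
  (1 <= r <= q)%nat ->
  exists K, forall t V, 0 < t <= 1 ->
    is_series (fun m => ap_ind r q (S m) * Rpower (INR (S m)) (- (1 + t))) V ->
    Rabs (V - / (INR q * t) - gamma_EL 0 r q) <= K * t.
Proof.
  (* A product of three factors [2]: the bound of [ap_err], the bound [2 * t * u ^ (-3/2)] for the
     difference of the weights, and the integral of [u ^ (-3/2)] over [[1, oo)]. *)
  intros Hr. exists 8. intros t V Ht HV.
  assert (Hq : 0 < INR q) by (apply lt_0_INR; lia).
  set (Phi := fun x => - Rpower x (- t) / t).
  assert (HPhi : forall x, 0 < x -> is_derive Phi x (logpow (1 + t) 0 x)).
  { intros x Hx. unfold Phi, logpow, Rpower. auto_derive; [ assumption | ].
    replace (- (1 + t) * ln x) with (- ln x + - t * ln x) by ring.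
    rewrite exp_plus, exp_Ropp, exp_ln by assumption. simpl. field. lra. }
  set (Z := ap_const (1 + t) 0 r q Phi).
  destruct (ap_logsum_asymp (1 + t) 0 r q Phi (t / 2) Hr ltac:(lra) HPhi)
    as [C1 [HC1 H1]]. fold Z in H1.
  destruct (ap_logsum_asymp 1 0 r q (fun y => ln y ^ (0 + 1) / INR (0 + 1)) (t / 2) Hr
    ltac:(lra) (is_derive_ln_pow 0)) as [C2 [HC2 H2]].
  rewrite <- gamma_EL_ap_const in H2.
  assert (EV : V = Z).
  { apply (is_lim_upto_series (fun m => ap_ind r q m * Rpower (INR m) (- (1 + t))) Z V); [ | exact HV ].
    apply (is_lim_of_rate _ _ (C1 + / t * / INR q) (t / 2)); [ lra | ].
    intros x Hx. destruct (H1 x Hx) as [H1' _].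
    replace (sum_upto (fun m => ap_ind r q m * Rpower (INR m) (- (1 + t))) x)
      with (ap_logsum (1 + t) 0 r q x).
    2: { apply sum_upto_ext. intros n _ _. unfold logpow. simpl. ring. }
    replace (ap_logsum (1 + t) 0 r q x - Z)
      with ((ap_logsum (1 + t) 0 r q x - Phi x / INR q - Z) + Phi x / INR q) by ring.
    eapply Rle_trans; [ apply Rabs_triang | ].
    rewrite Rmult_plus_distr_r. apply Rplus_le_compat; [ assumption | ].
    unfold Phi, Rdiv. rewrite !Rabs_mult, Rabs_Ropp.
    assert (0 < / t) by (apply Rinv_0_lt_compat; lra).
    assert (0 < / INR q) by (apply Rinv_0_lt_compat; lra).
    rewrite (Rabs_right (/ t)), (Rabs_right (/ INR q)), (Rabs_right (Rpower _ _))
      by (try (left; apply Rpower_pos); lra).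
    pose proof (Rpower_decreasing x (t / 2) t Hx ltac:(lra)).
    replace (Rpower x (- t) * / t * / INR q) with (/ t * / INR q * Rpower x (- t)) by ring.
    apply Rmult_le_compat_l; [ nra | assumption ]. }
  subst V.
  assert (E1 : (logpow (1 + t) 0 1 - Phi 1) / INR q = / INR q + / (INR q * t)).
  { unfold logpow, Phi, Rpower. rewrite ln_1, !Rmult_0_r, exp_0. simpl. field. lra. }
  assert (E2 : (logpow 1 0 1 - ln 1 ^ (0 + 1) / INR (0 + 1)) / INR q = / INR q).
  { unfold logpow, Rpower. rewrite ln_1, !Rmult_0_r, exp_0. simpl. field. lra. }
  rewrite E1 in H1. rewrite E2 in H2. clear E1 E2.
  set (f1 := fun u => logpow' (1 + t) 0 u / u * ap_err r q u) in *.
  set (f2 := fun u => logpow' 1 0 u / u * ap_err r q u) in *.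
  assert (Hint : forall Y, 1 <= Y -> Rabs (RInt f1 1 Y - RInt f2 1 Y) <= 8 * t).
  { intros Y HY.
    pose proof (is_RInt_minus (V := R_NormedModule) _ _ _ _ _ _
      (RInt_correct (V := R_CompleteNormedModule) _ _ _
        (ex_intro _ _ (ap_logsum_eq (1 + t) 0 r q Phi Y HY HPhi)))
      (RInt_correct (V := R_CompleteNormedModule) _ _ _
        (ex_intro _ _ (ap_logsum_eq 1 0 r q _ Y HY (is_derive_ln_pow 0))))) as HI.
    fold f1 f2 in HI.
    apply Rle_trans with (4 * t / (/ 2) * (Rpower 1 (- / 2) - Rpower Y (- / 2))).
    - apply (norm_RInt_le (V := R_NormedModule) (fun u => minus (f1 u) (f2 u))
        (fun u => 4 * t * Rpower u (- / 2 - 1)) 1 Y _ _ HY).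
      + intros u Hu. unfold norm; simpl; unfold abs, minus, plus, opp; simpl.
        unfold f1, f2.
        replace (logpow' (1 + t) 0 u / u * ap_err r q u + - (logpow' 1 0 u / u * ap_err r q u))
          with ((logpow' (1 + t) 0 u - logpow' 1 0 u) / u * ap_err r q u)
          by (field; lra).
        pose proof (ap_err_bound r q u Hr ltac:(lra)) as He.
        assert (Hd : Rabs ((logpow' (1 + t) 0 u - logpow' 1 0 u) / u)
                     <= 2 * t * Rpower u (- / 2 - 1)).
        { pose proof (ln_nonneg u ltac:(lra)) as Hl.
          assert (Hw1 : 1 - t * ln u <= Rpower u (- t)).
          { unfold Rpower. pose proof (exp_ineq1_le (- t * ln u)). lra. }
          pose proof (Rpower_le1 u t ltac:(lra) ltac:(lra)) as Hw2.
          (* The logarithm is paid for with half a power of [u]; what remains of [u ^ (-2)] is the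
             integrable [u ^ (-3/2)]. *)
          assert (Hw3 : 1 + ln u <= 2 * Rpower u (/ 2)).
          { unfold Rpower. pose proof (exp_ineq1_le (/ 2 * ln u)). lra. }
          assert (Hi : 0 < / u) by (apply Rinv_0_lt_compat; lra).
          assert (HR1 : Rpower u (- (1 + t)) = / u * Rpower u (- t)).
          { rewrite Ropp_plus_distr, Rpower_plus, (Rpower_Ropp u 1), Rpower_1 by lra.
            reflexivity. }
          assert (HR2 : Rpower u (- / 2 - 1) = / u * / u * Rpower u (/ 2)).
          { replace (- / 2 - 1) with (/ 2 + - (2)) by field.
            rewrite Rpower_plus, (Rpower_Ropp u 2).
            replace 2 with (INR 2) at 2 by reflexivity.
            rewrite Rpower_pow by lra. simpl. field. lra. }
          unfold logpow'. simpl. rewrite HR1, HR2.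
          rewrite (Rpower_Ropp u 1), Rpower_1 by lra.
          replace (((0 * 1 - (1 + t) * 1) * (/ u * Rpower u (- t)) - (0 * 1 - 1 * 1) * / u) / u)
            with (/ u * / u * (1 - (1 + t) * Rpower u (- t))) by (field; lra).
          rewrite Rabs_mult, (Rabs_right (/ u * / u)) by nra.
          replace (2 * t * (/ u * / u * Rpower u (/ 2)))
            with (/ u * / u * (t * (2 * Rpower u (/ 2)))) by ring.
          apply Rmult_le_compat_l; [ nra | ].
          apply Rle_trans with (t * (1 + ln u)); [ | nra ].
          pose proof (Rpower_pos u (- t)). assert (0 <= t * ln u) by nra.
          set (w := Rpower u (- t)) in *. assert (0 <= t * w <= t) by nra.
          apply Rabs_le. split; lra. }
        rewrite Rabs_mult. pose proof (Rpower_pos u (- / 2 - 1)).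
        pose proof (Rabs_pos (ap_err r q u)).
        apply Rle_trans with (2 * t * Rpower u (- / 2 - 1) * 2); [ | right; ring ].
        apply Rmult_le_compat; [ apply Rabs_pos | assumption | assumption | assumption ].
      + exact HI.
      + apply is_RInt_Rpower_tail; lra.
    - assert (Rpower 1 (- / 2) = 1) by (unfold Rpower; rewrite ln_1, Rmult_0_r; apply exp_0).
      pose proof (Rpower_pos Y (- / 2)). nra. }
  (* [C1] and [C2] depend on [t]. They serve only to pass to the limit at fixed [t] and leave no
     trace in the final bound. *)
  apply le_epsilon. intros eps Heps.
  destruct (Rpower_small (t / 2) (eps / (C1 + C2 + 1))) as [M [HM HM']]; [ lra | | ].
  { apply Rdiv_lt_0_compat; lra. }
  specialize (HM' M (Rle_refl M)). apply Rlt_div_r in HM'; [ | lra ].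
  destruct (H1 M HM) as [_ H1']. destruct (H2 M HM) as [_ H2']. specialize (Hint M HM).
  pose proof (Rpower_pos M (- (t / 2))).
  apply Rabs_le_between in H1', H2', Hint. apply Rabs_le. split; nra.
Qed.

Lemma is_zeta_ap_real (r q : nat) (Z : C -> C) (t : R) :
  is_zeta_ap r q Z -> 0 < t ->
  Im (Z (RtoC 1 + RtoC t)%C) = 0 /\
  is_series (fun m => ap_ind r q (S m) * Rpower (INR (S m)) (- (1 + t)))
    (Re (Z (RtoC 1 + RtoC t)%C)).
Proof.
  intros [_ HZ] Ht. specialize (HZ (RtoC 1 + RtoC t)%C).
  assert (Hre : 1 < Re (RtoC 1 + RtoC t)%C) by (unfold Re; simpl; lra).
  specialize (HZ Hre). apply is_Cseries_iff in HZ. destruct HZ as [H1 H2].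
  assert (E : forall m, (if congr (S m) r q
      then Rcpower (INR (S m)) (- (RtoC 1 + RtoC t))%C else RtoC 0)
    = RtoC (ap_ind r q (S m) * Rpower (INR (S m)) (- (1 + t)))).
  { intros m. unfold ap_ind. destruct (congr (S m) r q); [ | f_equal; ring ].
    unfold Rcpower, Cexp, Rpower. set (L := ln (INR (S m))).
    apply C_eq; unfold Re, Im; cbn [fst snd RtoC Cmult Copp Cplus].
    - replace (L * - (0 + 0) + 0 * - (1 + t)) with 0 by ring. rewrite cos_0.
      replace (L * - (1 + t) - 0 * - (0 + 0)) with (- (1 + t) * L) by ring. ring.
    - replace (L * - (0 + 0) + 0 * - (1 + t)) with 0 by ring. rewrite sin_0. ring. }
  split.
  - apply is_series_unique in H2. rewrite <- H2.
    rewrite (Series_ext _ (fun n => 0 * INR n)).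
    + rewrite Series_scal_l. ring.
    + intros n. rewrite E. unfold Im. simpl. ring.
  - revert H1. apply is_series_ext. intros n. now rewrite E.
Qed.

(** If [F] is bounded along the positive axis, then [w ^ (M + 1) * F w] tends to [0] there, so its
    zeroth coefficient vanishes and one factor [w] can be divided out. Induction removes them
    all. *)
Lemma expands_cancel (M : nat) : forall (a : nat -> C) (F : C -> C) (d e B : R),
  0 < d -> 0 < e ->
  (forall t, 0 < t < e -> Cmod (F (RtoC t)) <= B) ->
  expands a (fun w => (Cpow w M * F w)%C) d -> exists a', expands a' F d.
Proof.
  induction M as [ | M IH ]; intros a F d e B Hd He HB H.
  - exists a. revert H. apply expands_ext; [ reflexivity | ].
    intros w _. simpl. ring.
  - assert (Ha : a O = RtoC 0).
    { apply (expands_limit a (fun w => (Cpow w (S M) * F w)%C) d (Rmin e 1) B (RtoC 0) Hd); [ | exact H | ].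
      - apply Rmin_pos; lra.
      - intros t [Ht1 Ht2]. pose proof (Rmin_l e 1). pose proof (Rmin_r e 1).
        replace (RtoC t ^ S M * F (RtoC t) - RtoC 0)%C
          with (RtoC t ^ S M * F (RtoC t))%C by ring.
        rewrite Cmod_mult, Cmod_pow, Cmod_RtoC_pos by lra. simpl.
        specialize (HB t ltac:(lra)). pose proof (Cmod_ge_0 (F (RtoC t))).
        assert (0 <= t ^ M) by (apply pow_le; lra).
        assert (t ^ M <= 1) by (rewrite <- (pow1 M); apply pow_incr; lra).
        assert (t ^ M * Cmod (F (RtoC t)) <= B) by nra. nra. }
    apply (IH (fun n => a (S n)) F d e B Hd He HB).
    generalize (expands_tail _ _ _ H). apply expands_ext; [ reflexivity | ].
    intros w Hw. rewrite Ha. simpl. field. now apply Cmod_pos_neq.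
Qed.

(** Meromorphy provides an expansion, but of unknown order; the real estimate shows that
    [w * Z (1 + w)] stays bounded as [w] tends to [0] along the positive axis, which brings the
    order down to one. The quadratic error in [HF] is what allows the second coefficient to be read
    off. *)
Lemma zeta_expands (r q : nat) (Z : C -> C) :
  (1 <= r <= q)%nat -> is_zeta_ap r q Z ->
  exists a d, 0 < d /\ expands a (fun w => (w * Z (RtoC 1 + w))%C) d /\
    a 0%nat = RtoC (/ INR q) /\ a 1%nat = RtoC (gamma_EL 0 r q).
Proof.
  intros Hr HZ. destruct (zeta_real_rate r q Hr) as [K HK].
  set (g := gamma_EL 0 r q) in *.
  assert (Hq : 0 < INR q) by (apply lt_0_INR; lia).
  set (F := fun w => (w * Z (RtoC 1 + w))%C).
  assert (HF : forall t, 0 < t <= 1 ->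
      Cmod (F (RtoC t) - RtoC (/ INR q) - RtoC g * RtoC t)%C <= K * t * t).
  { intros t Ht. destruct (is_zeta_ap_real r q Z t HZ ltac:(lra)) as [HIm HRe].
    specialize (HK t _ Ht HRe). unfold F. set (z := Z (RtoC 1 + RtoC t)%C) in *.
    replace (RtoC t * z - RtoC (/ INR q) - RtoC g * RtoC t)%C
      with (RtoC (t * (Re z - / (INR q * t) - g))).
    - rewrite Cmod_R, Rabs_mult, Rabs_right by lra. nra.
    - destruct z as [x y]. unfold Im in HIm. simpl in HIm. subst y.
      apply C_eq; unfold Re, Im; simpl; field; lra. }
  assert (Hex : exists a d, 0 < d /\ expands a F d).
  { destruct HZ as [HM _]. destruct (HM (RtoC 1)) as [N [a [d [Hd Ha]]]].
    assert (Ha' : expands a (fun w => (Cpow w N * Z (RtoC 1 + w))%C) d).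
    { intros w Hw. specialize (Ha (RtoC 1 + w)%C).
      replace (RtoC 1 + w - RtoC 1)%C with w in Ha by ring.
      apply is_pseries_Cpseries. now apply Ha. }
    (* The target has order exactly one: from order [0] a factor [w] is supplied, from order [M + 1]
       the [M] excess factors are cancelled. *)
    destruct N as [ | M ].
    - eexists. exists d. split; [ assumption | ].
      generalize (expands_shift _ _ _ Ha'). apply expands_ext; [ reflexivity | ].
      intros w _. unfold F. simpl. ring.
    - destruct (expands_cancel M a F d 1 (/ INR q + Rabs g + Rabs K)) as [a' H'].
      + assumption.
      + lra.
      + intros t Ht. specialize (HF t ltac:(lra)).
        replace (F (RtoC t)) with ((F (RtoC t) - RtoC (/ INR q) - RtoC g * RtoC t)
          + (RtoC (/ INR q) + RtoC g * RtoC t))%C by ring.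
        eapply Rle_trans; [ apply Cmod_triangle | ].
        assert (Cmod (RtoC (/ INR q) + RtoC g * RtoC t)%C <= / INR q + Rabs g).
        { eapply Rle_trans; [ apply Cmod_triangle | ].
          rewrite Cmod_mult, !Cmod_R, (Rabs_right (/ _)), (Rabs_right t)
            by (try (apply Rle_ge; left; apply Rinv_0_lt_compat); lra).
          pose proof (Rabs_pos g). nra. }
        assert (K * t * t <= Rabs K).
        { pose proof (Rle_abs K). pose proof (Rabs_pos K).
          assert (0 <= t * t <= 1) by nra. rewrite Rmult_assoc. nra. }
        lra.
      + revert Ha'. apply expands_ext; [ reflexivity | ].
        intros w _. unfold F. simpl. ring.
      + now exists a', d. }
  destruct Hex as [a [d [Hd Ha]]]. exists a, d.
  assert (H0 : a O = RtoC (/ INR q)).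
  { apply (expands_limit a F d 1 (Rabs g + Rabs K)); [ assumption | lra | assumption | ].
    intros t Ht. specialize (HF t ltac:(lra)).
    replace (F (RtoC t) - RtoC (/ INR q))%C
      with ((F (RtoC t) - RtoC (/ INR q) - RtoC g * RtoC t) + RtoC g * RtoC t)%C by ring.
    eapply Rle_trans; [ apply Cmod_triangle | ].
    rewrite Cmod_mult, !Cmod_R, (Rabs_right t) by lra.
    pose proof (Rle_abs K). pose proof (Rabs_pos K).
    assert (0 <= t * t <= t) by nra.
    assert (K * t * t <= Rabs K * t) by (rewrite Rmult_assoc; nra). lra. }
  split; [ assumption | ]. split; [ assumption | ]. split; [ assumption | ].
  apply (expands_limit (fun n => a (S n)) (fun w => ((F w - a O) / w)%C) d 1 K);
    [ assumption | lra | now apply expands_tail | ].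
  intros t Ht. specialize (HF t ltac:(lra)). rewrite H0.
  assert (Hn : RtoC t <> RtoC 0) by (apply Cmod_pos_neq; rewrite Cmod_RtoC_pos; lra).
  replace ((F (RtoC t) - RtoC (/ INR q)) / RtoC t - RtoC g)%C
    with ((F (RtoC t) - RtoC (/ INR q) - RtoC g * RtoC t) / RtoC t)%C
    by (field; assumption).
  rewrite Cmod_div, Cmod_RtoC_pos by (assumption || lra).
  apply Rle_div_l; lra.
Qed.

(** * The residue in closed form *)

Lemma laurent_expands (f : C -> C) (N : nat) (a : nat -> C) :
  laurent_at f (RtoC 1) N a <->
  exists d, 0 < d /\ expands a (fun w => (Cpow w N * f (RtoC 1 + w))%C) d.
Proof.
  split; intros [d [Hd H]]; exists d; (split; [ assumption | ]).
  - intros w Hw. apply is_pseries_Cpseries.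
    specialize (H (RtoC 1 + w)%C). replace (RtoC 1 + w - RtoC 1)%C with w in H by ring.
    now apply H.
  - intros s Hs. apply is_pseries_Cpseries. specialize (H _ Hs). cbv beta in H.
    replace (RtoC 1 + (s - RtoC 1))%C with s in H by ring. exact H.
Qed.

(** [epsilon] may return the coefficient of any expansion, of any order; [expands_unique] shows that
    all of them give the same residue. *)
Lemma residue_eq (f : C -> C) (m : nat) (a : nat -> C) :
  laurent_at f (RtoC 1) (S m) a -> residue f (RtoC 1) = a m.
Proof.
  intros H. unfold residue.
  assert (Hr : is_residue f (RtoC 1) (epsilon (inhabits (RtoC 0)) (is_residue f (RtoC 1)))).
  { apply epsilon_spec. exists (a m), m, a. now split. }
  destruct Hr as [m' [a' [H' ->]]].
  apply laurent_expands in H, H'. destruct H as [d [Hd H]], H' as [d' [Hd' H']].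
  apply (expands_unique (S m') (S m) m' m a' a (fun w => f (RtoC 1 + w)%C) d' d);
    assumption || lia.
Qed.

Definition main_term (r1 q1 r2 q2 : nat) (x : R) : R :=
  x * (ln x / (INR q1 * INR q2) + gamma_EL 0 r1 q1 / INR q2 + gamma_EL 0 r2 q2 / INR q1
       - 1 / (INR q1 * INR q2)).

(** [main_term] is the coefficient of [w] in [(1/q1 + g1 w)(1/q2 + g2 w) * x (1 + w ln x) * (1 -
    w)], where [g1] and [g2] are the two gamma_0; the last two factors are [x ^ s] and [1 / s] at
    [s = 1 + w]. *)
Lemma Delta2_eq (r1 q1 r2 q2 : nat) (Z1 Z2 : C -> C) (x : R) :
  (1 <= r1 <= q1)%nat -> (1 <= r2 <= q2)%nat ->
  is_zeta_ap r1 q1 Z1 -> is_zeta_ap r2 q2 Z2 -> 0 < x ->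
  Delta2 r1 q1 r2 q2 Z1 Z2 x
  = sum_upto (fun n => INR (dstar r1 q1 r2 q2 n)) x - main_term r1 q1 r2 q2 x.
Proof.
  intros Hr1 Hr2 HZ1 HZ2 Hx. unfold Delta2. f_equal.
  destruct (zeta_expands r1 q1 Z1 Hr1 HZ1) as [a1 [d1 [Hd1 [H1 [H10 H11]]]]].
  destruct (zeta_expands r2 q2 Z2 Hr2 HZ2) as [a2 [d2 [Hd2 [H2 [H20 H21]]]]].
  set (b := fun n => RtoC (x * ln x ^ n / INR (fact n))).
  set (c := fun n => RtoC ((-1) ^ n)).
  set (d := Rmin 1 (Rmin d1 d2)).
  assert (Hd : 0 < d <= 1 /\ d <= d1 /\ d <= d2).
  { pose proof (Rmin_l 1 (Rmin d1 d2)). pose proof (Rmin_r 1 (Rmin d1 d2)).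
    pose proof (Rmin_l d1 d2). pose proof (Rmin_r d1 d2). unfold d.
    repeat split; try lra. repeat apply Rmin_pos; lra. }
  (* The pole is double, so the residue is the coefficient of index [1] after multiplication by
     [w ^ 2]. *)
  rewrite (residue_eq _ 1 (conv (conv a1 a2) (conv b c))).
  - unfold conv. change (1 - 0)%nat with 1%nat. change (1 - 1)%nat with 0%nat.
    rewrite !sum_Sn, !sum_O. cbn [Nat.sub]. change (@plus C_AbelianMonoid) with Cplus.
    rewrite !sum_Sn, !sum_O. cbn [Nat.sub]. change (@plus C_AbelianMonoid) with Cplus.
    rewrite H10, H11, H20, H21. unfold b, c, main_term.
    assert (0 < INR q1) by (apply lt_0_INR; lia).
    assert (0 < INR q2) by (apply lt_0_INR; lia).
    unfold Re. simpl. field. lra.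
  - apply laurent_expands. exists d. split; [ lra | ].
    pose proof (expands_mult _ _ _ _ d
      (expands_mult _ _ _ _ d (expands_subset _ _ d1 d ltac:(lra) H1)
        (expands_subset _ _ d2 d ltac:(lra) H2))
      (expands_mult _ _ _ _ d (Rcpower_expands x d Hx)
        (expands_subset _ _ 1 d ltac:(lra) inv_expands))) as H.
    revert H. apply expands_ext; [ reflexivity | ].
    intros w Hw. assert (Cmod w < 1) by lra. simpl. field. now apply Cgeom_neq.
Qed.

(** * The divisor sum integrated against the weight *)

Lemma sum_n_scal (c : R) (f : nat -> R) (n : nat) :
  sum_n (fun i => c * f i) n = c * sum_n f n.
Proof. exact (sum_n_mult_l (K := R_Ring) c f n). Qed.

Lemma sum_n_add (f g : nat -> R) (n : nat) :
  sum_n (fun i => f i + g i) n = sum_n f n + sum_n g n.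
Proof. exact (sum_n_plus (G := R_AbelianMonoid) f g n). Qed.

Lemma sum_n_sum_1_switch (f : nat -> nat -> R) (n m : nat) :
  sum_n (fun i => sum_n_m (fun b => f i b) 1 m) n
  = sum_n_m (fun b => sum_n (fun i => f i b) n) 1 m.
Proof.
  induction n as [ | n IH ].
  - rewrite sum_O. apply sum_n_m_ext. intros b. now rewrite sum_O.
  - rewrite sum_Sn, IH. unfold plus; simpl. rewrite <- sum_1_plus.
    apply sum_n_m_ext. intros b. now rewrite sum_Sn.
Qed.

Lemma sum_n_bound {T : Type} (h : nat -> T -> R) (B : T -> R) (P : T -> Prop) (n : nat) :
  (forall i, exists K, forall t, P t -> Rabs (h i t) <= K * B t) ->
  exists K, forall t, P t -> Rabs (sum_n (fun i => h i t) n) <= K * B t.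
Proof.
  intros H. induction n as [ | n [K IH] ].
  - destruct (H 0%nat) as [K HK]. exists K. intros t Ht. rewrite sum_O. now apply HK.
  - destruct (H (S n)) as [K' HK']. exists (K + K'). intros t Ht. rewrite sum_Sn.
    eapply Rle_trans; [ apply Rabs_triang | ]. rewrite Rmult_plus_distr_r.
    apply Rplus_le_compat; auto.
Qed.

Lemma is_lim_sum_n (f : nat -> R -> R) (l : nat -> R) (n : nat) :
  (forall i, (i <= n)%nat -> is_lim (f i) p_infty (l i)) ->
  is_lim (fun x => sum_n (fun i => f i x) n) p_infty (sum_n l n).
Proof.
  induction n as [ | n IH ]; intros H.
  - rewrite sum_O. apply is_lim_ext with (f 0%nat); [ intros; now rewrite sum_O | ].
    now apply H.
  - rewrite sum_Sn. apply is_lim_ext with (fun x => sum_n (fun i => f i x) n + f (S n) x).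
    + intros x. now rewrite sum_Sn.
    + apply is_lim_plus'; [ apply IH; intros; apply H; lia | now apply H ].
Qed.

(** This separation of variables is what lets sums over [b] be taken inside an integral over [v]; it
    is also where the binomial coefficients of the theorem originate. *)
Lemma logpow_mult (a : R) (k : nat) (u v : R) :
  0 < u -> 0 < v ->
  logpow a k (u * v)
  = sum_n (fun i => Binomial.C k i * logpow a (k - i) u * logpow a i v) k.
Proof.
  intros Hu Hv. unfold logpow at 1.
  rewrite ln_mult by assumption.
  rewrite <- (Rpower_mult_distr u v) by assumption.
  rewrite (Rplus_comm (ln u)), binomial, <- sum_n_Reals, Rmult_comm, <- sum_n_scal.
  apply sum_n_ext. intros i. unfold logpow. rring.
Qed.

(** Follows from [logpow_mult] by differentiating in [v] and multiplying by [v]; no binomial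
    identity is involved. *)
Lemma logpow'_mult (a : R) (k : nat) (u v : R) :
  0 < u -> 0 < v ->
  logpow' a k (u * v)
  = sum_n (fun i => Binomial.C k i * logpow' a i v * logpow a (k - i) u) k.
Proof.
  intros Hu Hv.
  assert (H1 : is_derive (fun y => logpow a k (u * y)) v (logpow' a k (u * v) / v)).
  { evar_last.
    - apply (is_derive_comp (logpow a k) (fun y => u * y)).
      + apply is_derive_logpow. now apply Rmult_lt_0_compat.
      + apply (is_derive_scal (fun y : R => y)). apply is_derive_id.
    - unfold scal, one; simpl; unfold mult; simpl. field. lra. }
  assert (H2 : is_derive
      (fun y => sum_n (fun i => Binomial.C k i * logpow a (k - i) u * logpow a i y) k) v
      (sum_n (fun i => Binomial.C k i * logpow a (k - i) u * (logpow' a i v / v)) k)).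
  { apply (is_derive_sum_n
      (fun i y => Binomial.C k i * logpow a (k - i) u * logpow a i y)).
    intros i _. apply (is_derive_scal (logpow a i)), is_derive_logpow. assumption. }
  assert (H3 : is_derive (fun y => logpow a k (u * y)) v
      (sum_n (fun i => Binomial.C k i * logpow a (k - i) u * (logpow' a i v / v)) k)).
  { apply is_derive_ext_loc with (2 := H2).
    exists (mkposreal v Hv). intros y Hy. symmetry. apply logpow_mult; [ assumption | ].
    unfold ball in Hy; simpl in Hy. unfold AbsRing_ball, abs, minus, plus, opp in Hy.
    simpl in Hy. apply Rabs_lt_between in Hy. lra. }
  apply is_derive_unique in H1, H3. rewrite H1 in H3.
  replace (logpow' a k (u * v)) with (v * (logpow' a k (u * v) / v)) by (field; lra).
  rewrite H3, <- sum_n_scal. apply sum_n_ext. intros i. eqR. field. lra.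
Qed.

(** [W] collects the part of [ap_err r1 q1], the sum with [Om] the part [v / q1] of the counting
    function: substituting [x = b * v], the latter integrates [logpow' a k] from [b] to [X]. *)
Lemma dstar_integral (a : R) (k r1 q1 r2 q2 : nat) (Om : R -> R) (X : R) :
  (1 <= r1 <= q1)%nat -> 1 <= X ->
  (forall x, 0 < x -> is_derive Om x (logpow' a k x)) ->
  exists W,
  is_RInt (fun v => ap_err r1 q1 v / v
      * sum_n (fun i => Binomial.C k i * logpow' a i v * ap_logsum a (k - i) r2 q2 (X / v)) k)
    1 X W /\
  is_RInt (fun x => - logpow' a k x / x
      * sum_upto (fun n => INR (dstar r1 q1 r2 q2 n)) x) 1 X
    (- W - sum_upto (fun b => ap_ind r2 q2 b * ((Om X - Om (INR b)) / INR b)) X / INR q1).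
Proof.
  intros Hr HX HOm.
  assert (Hq : 0 < INR q1) by (apply lt_0_INR; lia).
  destruct (nfloor_spec X) as [Hm1 Hm2]; [ lra | ].
  set (m := Z.to_nat (Int_part X)) in *.
  (* The value that [ap_err_integral] gives for the integral over [[1, X / b]]. The products
     [b * (X / b)] and [b * 1] stay unsimplified, to match that lemma. *)
  set (I := fun b : nat => sum_upto (fun n => ap_ind r1 q1 n
       * (logpow a k (INR b * (X / INR b)) - logpow a k (INR b * INR n))) (X / INR b)
     - (Om (INR b * (X / INR b)) / INR b - Om (INR b * 1) / INR b) / INR q1).
  assert (HI : forall b, (1 <= b <= m)%nat -> 1 <= INR b <= X /\ 1 <= X / INR b <= X /\
    is_RInt (fun v => logpow' a k (INR b * v) / v * ap_err r1 q1 v) 1 (X / INR b) (I b)).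
  { intros b Hb.
    assert (Hb1 : 1 <= INR b) by (apply (le_INR 1); lia).
    assert (Hb2 : INR b <= X) by (apply Rle_trans with (2 := Hm1), le_INR; lia).
    assert (HXb : 1 <= X / INR b) by (apply Rle_div_r; lra).
    split; [ lra | ]. split.
    { split; [ assumption | ]. apply Rle_div_l; nra. }
    apply (ap_err_integral r1 q1 (fun v => logpow a k (INR b * v))
      (fun v => Om (INR b * v) / INR b)); [ assumption | | | ].
    - intros u Hu. evar_last.
      + apply (is_derive_comp (logpow a k) (fun y => INR b * y)).
        * apply is_derive_logpow. nra.
        * apply (is_derive_scal (fun y : R => y)). apply is_derive_id.
      + unfold scal, one; simpl; unfold mult; simpl. field. lra.
    - intros u Hu. apply (continuous_mult (fun v => logpow' a k (INR b * v))).
      + apply (continuous_comp (fun v => INR b * v) (logpow' a k)).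
        * apply (continuous_mult (fun _ => INR b)); [ apply continuous_const | apply continuous_id ].
        * apply continuous_logpow'. nra.
      + apply continuous_Rinv. lra.
    - intros u Hu. eapply is_derive_ext with (fun v => / INR b * Om (INR b * v)).
      { intros. unfold Rdiv. apply Rmult_comm. }
      evar_last.
      + apply (is_derive_scal (fun v => Om (INR b * v))).
        apply (is_derive_comp Om (fun y => INR b * y)).
        * apply HOm. nra.
        * apply (is_derive_scal (fun y : R => y)). apply is_derive_id.
      + unfold scal, one; simpl; unfold mult; simpl. field. lra. }
  exists (sum_n_m (fun b => ap_ind r2 q2 b * I b) 1 m). split.
  - apply is_RInt_ext with (fun v => sum_n_m (fun b => ap_ind r2 q2 b
      * (logpow' a k (INR b * v) / v * ap_err r1 q1 v * ustep b (X / v))) 1 m).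
    + rewrite Rmin_left, Rmax_right by assumption. intros v Hv.
      assert (HXv : 0 <= X / v < INR m + 1).
      { split; [ apply Rdiv_le_0_compat; lra | ].
        apply Rle_lt_trans with (2 := Hm2). apply Rle_div_l; nra. }
      rewrite <- sum_n_scal.
      (* After the separation the cutoff factor restricts the sum over [b] to [b <= X / v], so the
         inner sum is [ap_logsum] at [X / v]. *)
      transitivity (sum_n (fun i => sum_n_m (fun b => ap_err r1 q1 v / v
        * (Binomial.C k i * logpow' a i v
           * (ap_ind r2 q2 b * logpow a (k - i) (INR b) * ustep b (X / v)))) 1 m) k).
      * rewrite sum_n_sum_1_switch. apply sum_n_m_ext_loc. intros b Hb.
        rewrite logpow'_mult by (lra || (apply lt_0_INR; lia)).
        transitivity (ap_ind r2 q2 b * ustep b (X / v) * (ap_err r1 q1 v / v)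
          * sum_n (fun i => Binomial.C k i * logpow' a i v * logpow a (k - i) (INR b)) k).
        { eqR. gen_sums. field. lra. }
        rewrite <- sum_n_scal. apply sum_n_ext. intros i. rring.
      * apply sum_n_ext. intros i. unfold ap_logsum.
        rewrite (sum_upto_ind _ _ m HXv), <- !sum_1_scal. apply sum_n_m_ext.
        intros b. rring.
    + apply is_RInt_sum_1 with (f := fun b v => ap_ind r2 q2 b
        * (logpow' a k (INR b * v) / v * ap_err r1 q1 v * ustep b (X / v))).
      intros b Hb. destruct (HI b Hb) as [H1 [H2 H3]].
      apply (is_RInt_scal (V := R_NormedModule)).
      apply is_RInt_ind_le; [ lia | lra | lra | exact H3 ].
  - eapply is_RInt_eqv.
    + apply (abel_summation _ (fun x => - logpow a k x)); [ assumption | | ].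
      * intros u Hu. evar_last.
        -- apply (is_derive_opp (logpow a k)), is_derive_logpow. lra.
        -- unfold opp; simpl. field. lra.
      * intros u Hu. apply (continuous_mult (fun x => - logpow' a k x)).
        -- apply (continuous_opp (logpow' a k)), continuous_logpow'. lra.
        -- apply continuous_Rinv. lra.
    + rewrite (sum_upto_dstar r1 q1 r2 q2 (fun n => - logpow a k X - - logpow a k (INR n)))
        by lra.
      unfold sum_upto at 1 3. fold m.
      transitivity (sum_n_m (fun b => -1 * (ap_ind r2 q2 b * I b)
        + - / INR q1 * (ap_ind r2 q2 b * ((Om X - Om (INR b)) / INR b))) 1 m).
      2: { rewrite sum_1_plus, !sum_1_scal. unfold Rdiv. rring. }
      apply sum_n_m_ext_loc. intros b Hb. destruct (HI b Hb) as [H1 _]. unfold I.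
      replace (INR b * (X / INR b)) with X by (field; lra). rewrite Rmult_1_r.
      transitivity (ap_ind r2 q2 b * (-1 * sum_upto (fun n => ap_ind r1 q1 n
        * (logpow a k X - logpow a k (INR b * INR n))) (X / INR b))).
      2: { unfold sum_upto. eqR. gen_sums. field. lra. }
      f_equal. unfold sum_upto. rewrite <- sum_1_scal. apply sum_n_m_ext.
      intros n. rewrite mult_INR, (Rmult_comm (INR n)). rring.
Qed.

Lemma is_lim_0_of_rate (f : R -> R) (C b : R) :
  0 < b -> (forall x, 1 <= x -> Rabs (f x) <= C * Rpower x (- b)) -> is_lim f p_infty 0.
Proof.
  intros Hb Hf. apply (is_lim_of_rate f 0 C b Hb). intros x Hx.
  rewrite Rminus_0_r. now apply Hf.
Qed.

Lemma derive_eq (f : R -> R) (x l l' : R) : is_derive f x l -> is_derive f x l' -> l = l'.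
Proof. intros H H'. apply is_derive_unique in H, H'. congruence. Qed.

Lemma const_of_derive_0 (f : R -> R) (x y : R) :
  0 < x -> 0 < y -> (forall u, 0 < u -> is_derive f u 0) -> f x = f y.
Proof.
  intros Hx Hy H.
  destruct (MVT_gen f x y (fun _ => 0)) as [c [_ Hc]].
  - intros u Hu. apply H. apply Rlt_trans with (2 := proj1 Hu). now apply Rmin_pos.
  - intros u Hu. apply continuity_pt_filterlim.
    apply continuous_of_derive with 0. apply H.
    apply Rlt_le_trans with (2 := proj1 Hu). now apply Rmin_pos.
  - lra.
Qed.

(** As functions of [X] both sides have the same derivative, by [logpow'_mult] at the product
    [(X / v) * v]; the constant is found at [X = v]. This evaluates the combined main terms of the
    inner sums. *)
Lemma logpow'_Phi_conv (a : R) (k : nat) (Phi : nat -> R -> R) (X v : R) :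
  (forall j x, 0 < x -> is_derive (Phi j) x (logpow a j x)) -> 0 < v -> 0 < X ->
  sum_n (fun i => Binomial.C k i * logpow' a i v * Phi (k - i)%nat (X / v)) k
  = ((X * logpow a k X - Phi k X) - (v * logpow a k v - Phi k v)) / v
    + sum_n (fun i => Binomial.C k i * logpow' a i v * Phi (k - i)%nat 1) k.
Proof.
  intros HPhi Hv HX.
  set (f := fun X => sum_n (fun i => Binomial.C k i * logpow' a i v * Phi (k - i)%nat (X / v)) k
    - (X * logpow a k X - Phi k X) / v).
  assert (E : f X = f v).
  { apply const_of_derive_0; [ assumption | assumption | ]. intros u Hu. unfold f.
    assert (Huv : 0 < u / v) by now apply Rdiv_lt_0_compat.
    evar_last.
    - apply (is_derive_minus (fun X => sum_n (fun i =>
        Binomial.C k i * logpow' a i v * Phi (k - i)%nat (X / v)) k)).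
      + apply (is_derive_sum_n
          (fun i X => Binomial.C k i * logpow' a i v * Phi (k - i)%nat (X / v)) k u
          (fun i => Binomial.C k i * logpow' a i v * (/ v * logpow a (k - i) (u / v)))).
        intros i _. apply (is_derive_scal (fun X => Phi (k - i)%nat (X / v))).
        apply (is_derive_comp (Phi (k - i)%nat) (fun X => X / v)).
        * now apply HPhi.
        * apply is_derive_ext with (fun X => / v * X).
          { intros. unfold Rdiv. apply Rmult_comm. }
          evar_last; [ apply (is_derive_scal (fun y : R => y)); apply is_derive_id | ].
          unfold scal, one; simpl; unfold mult; simpl. ring.
      + apply is_derive_ext with (fun X => / v * (X * logpow a k X - Phi k X)).
        { intros. unfold Rdiv. apply Rmult_comm. }
        apply (is_derive_scal (fun X => X * logpow a k X - Phi k X)).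
        apply (is_derive_minus (fun x => x * logpow a k x)); [ | now apply HPhi ].
        apply (is_derive_mult (fun x : R => x)); [ apply is_derive_id
          | apply is_derive_logpow; assumption | intros; apply Rmult_comm ].
    - transitivity (/ v * sum_n (fun i =>
        Binomial.C k i * logpow' a i v * logpow a (k - i) (u / v)) k
        - / v * (logpow' a k (u / v * v))).
      + rewrite <- sum_n_scal. unfold minus, plus, opp, scal; simpl.
        unfold mult, one, scal; simpl. unfold mult; simpl.
        replace (u / v * v) with u by (field; lra).
        apply (f_equal2 Rminus).
        * apply sum_n_ext. intros i. rring.
        * field. lra.
      + rewrite logpow'_mult by assumption. rring. }
  unfold f in E.
  replace (v / v) with 1 in E by (field; lra).
  lazymatch type of E with ?p - ?q = ?r - ?s => assert (E' : p = q + (r - s)) by lra end.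
  rewrite E'. unfold Rdiv. rring.
Qed.

(** * The integral for both kinds of constants *)

Section RegularizedIntegral.

(* [Phi j] is the main term subtracted in the definition of the constants, and
   [rho] gives the coefficients of [Phi k x / x] in terms of the [logpow a l]; this
   treats [alpha = 1] and [alpha < 1] at once. *)
Variables (a : R) (k r1 q1 r2 q2 : nat) (Phi : nat -> R -> R) (rho : nat -> R).
Hypothesis Ha : 0 < a <= 1.
Hypothesis Hr1 : (1 <= r1 <= q1)%nat.
Hypothesis Hr2 : (1 <= r2 <= q2)%nat.
Hypothesis HPhi : forall j x, 0 < x -> is_derive (Phi j) x (logpow a j x).
Hypothesis Hrho : forall x, 0 < x ->
  Phi k x = x * sum_n (fun l => rho l * logpow a l x) (k + 1).

(** The antiderivative of [logpow' a k] obtained by parts. *)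
Let Om (x : R) : R := x * logpow a k x - Phi k x.
Let Z1 (j : nat) : R := ap_const a j r1 q1 (Phi j).
Let Z2 (j : nat) : R := ap_const a j r2 q2 (Phi j).
(** The limit at infinity of the integral [RI j], as given by [ap_logsum_asymp]. *)
Let J1 (j : nat) : R := (logpow a j 1 - Phi j 1) / INR q1 - Z1 j.
Let G : R := gamma_EL 0 r1 q1 / INR q2 + gamma_EL 0 r2 q2 / INR q1.

Lemma is_derive_Om (x : R) : 0 < x -> is_derive Om x (logpow' a k x).
Proof.
  intros Hx. unfold Om. evar_last.
  - apply (is_derive_minus (fun x => x * logpow a k x)); [ | now apply HPhi ].
    apply (is_derive_mult (fun x : R => x)); [ apply is_derive_id
      | apply is_derive_logpow; assumption | intros; apply Rmult_comm ].
  - unfold minus, plus, opp, mult, one; simpl. field. lra.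
Qed.

(** Differentiating the relation [Hrho] shows that [logpow a k] is the sum of the
    [rho l * (logpow a l + logpow' a l)]; subtracting [Hrho] itself leaves the second half. So [rho]
    serves for [Om] too. *)
Lemma Om_eq (x : R) :
  0 < x -> Om x = x * sum_n (fun l => rho l * logpow' a l x) (k + 1).
Proof.
  intros Hx.
  assert (H1 : is_derive (fun y => sum_n (fun l => rho l * logpow a l y) (k + 1)) x
      (sum_n (fun l => rho l * (logpow' a l x / x)) (k + 1))).
  { apply (is_derive_sum_n (fun l y => rho l * logpow a l y)). intros l _.
    now apply (is_derive_scal (logpow a l)), is_derive_logpow. }
  assert (H2 : is_derive (Phi k) x
      (sum_n (fun l => rho l * logpow a l x) (k + 1)
       + x * sum_n (fun l => rho l * (logpow' a l x / x)) (k + 1))).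
  { apply is_derive_ext_loc with (fun y => y * sum_n (fun l => rho l * logpow a l y) (k + 1)).
    - exists (mkposreal x Hx). intros y Hy. symmetry. apply Hrho.
      unfold ball in Hy; simpl in Hy. unfold AbsRing_ball, abs, minus, plus, opp in Hy.
      simpl in Hy. apply Rabs_lt_between in Hy. lra.
    - evar_last.
      + apply (is_derive_mult (fun x : R => x)); [ apply is_derive_id | exact H1
          | intros; apply Rmult_comm ].
      + unfold plus, mult, one; simpl. rring. }
  pose proof (derive_eq _ _ _ _ H2 (HPhi k x Hx)) as E.
  unfold Om. rewrite (Hrho x Hx), <- E, <- !sum_n_scal.
  rewrite Rmult_plus_distr_l, <- !sum_n_scal.
  transitivity (sum_n (fun i => x * (x * (rho i * (logpow' a i x / x)))) (k + 1)).
  - rring.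
  - apply sum_n_ext. intros l. eqR. field. lra.
Qed.

(** The last two terms are the contribution of the lower end point [1] in the integral of
    [main_term]; the others are limits at infinity. *)
Definition integral_limit : R :=
  (Z2 k - sum_n (fun l => rho l * Z2 l) (k + 1)) / INR q1
  - sum_n (fun i => Binomial.C k i * (Z2 (k - i)%nat + Phi (k - i)%nat 1 / INR q2) * J1 i) k
  + sum_n (fun l => rho l * J1 l) (k + 1) / INR q2
  + (Phi k 1 - sum_n (fun l => rho l * Phi l 1) (k + 1)) / (INR q1 * INR q2)
  - Om 1 * (G - 1 / (INR q1 * INR q2)).

Let RI (j : nat) (X : R) : R :=
  RInt (fun u => logpow' a j u / u * ap_err r1 q1 u) 1 X.
Let S2 (j : nat) (X : R) : R := ap_logsum a j r2 q2 X.

(** The integral of [ap_err r1 q1 u / u ^ 2], because [logpow' 1 0 u = -1 / u]; in this form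
    [ap_logsum_asymp] applies to it. *)
Let T (X : R) : R := - RInt (fun u => logpow' 1 0 u / u * ap_err r1 q1 u) 1 X.

Lemma RI_correct (j : nat) (X : R) :
  1 <= X -> is_RInt (fun u => logpow' a j u / u * ap_err r1 q1 u) 1 X (RI j X).
Proof.
  intros HX. apply (RInt_correct (V := R_CompleteNormedModule)). eexists.
  apply (ap_logsum_eq a j r1 q1 (Phi j) X HX (HPhi j)).
Qed.

Lemma T_correct (X : R) :
  1 <= X -> is_RInt (fun u => ap_err r1 q1 u / u ^ 2) 1 X (T X).
Proof.
  intros HX. apply is_RInt_ext with (fun u => opp (logpow' 1 0 u / u * ap_err r1 q1 u)).
  - rewrite Rmin_left, Rmax_right by assumption. intros u Hu.
    unfold logpow', opp; simpl. rewrite Rpower_Ropp, Rpower_1 by lra. field. lra.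
  - apply (is_RInt_opp (V := R_NormedModule)).
    apply (RInt_correct (V := R_CompleteNormedModule)). eexists.
    apply (ap_logsum_eq 1 0 r1 q1 _ X HX (is_derive_ln_pow 0)).
Qed.

(** By [logpow'_Phi_conv] the main terms combine to [(Om X - Om v) / v] plus values at [1]. The
    first half produces [Om X * T X], and by [Om_eq] the second half produces the integrals
    [RI l]. *)
Lemma inner_integral_main (X : R) :
  1 <= X ->
  is_RInt (fun v => ap_err r1 q1 v / v * sum_n (fun i => Binomial.C k i * logpow' a i v
      * (Phi (k - i)%nat (X / v) / INR q2 + Z2 (k - i)%nat)) k) 1 X
    (sum_n (fun i => Binomial.C k i * (Z2 (k - i)%nat + Phi (k - i)%nat 1 / INR q2) * RI i X) k
     + (Om X * T X - sum_n (fun l => rho l * RI l X) (k + 1)) / INR q2).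
Proof.
  intros HX.
  assert (Hq : INR q2 <> 0) by (apply not_0_INR; lia).
  apply is_RInt_ext with (fun v =>
    plus (sum_n (fun i => Binomial.C k i * (Z2 (k - i)%nat + Phi (k - i)%nat 1 / INR q2)
            * (logpow' a i v / v * ap_err r1 q1 v)) k)
      (scal (/ INR q2) (minus (scal (Om X) (ap_err r1 q1 v / v ^ 2))
        (sum_n (fun l => rho l * (logpow' a l v / v * ap_err r1 q1 v)) (k + 1))))).
  - rewrite Rmin_left, Rmax_right by assumption. intros v Hv.
    pose proof (logpow'_Phi_conv a k Phi X v HPhi ltac:(lra) ltac:(lra)) as E.
    fold (Om X) (Om v) in E. rewrite (Om_eq v) in E by lra.
    transitivity (ap_err r1 q1 v / v *
      (sum_n (fun i => Binomial.C k i * logpow' a i v * Z2 (k - i)%nat) k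
       + / INR q2
       * sum_n (fun i => Binomial.C k i * logpow' a i v * Phi (k - i)%nat (X / v)) k)).
    2: { f_equal. rewrite <- sum_n_scal, <- sum_n_add. apply sum_n_ext. intros i.
         unfold Rdiv. rring. }
    rewrite E. unfold minus, plus, opp, scal; simpl; unfold mult; simpl.
    transitivity (ap_err r1 q1 v / v * (sum_n (fun i => Binomial.C k i
          * (Z2 (k - i)%nat + Phi (k - i)%nat 1 / INR q2) * logpow' a i v) k
        + / INR q2 * (Om X / v - sum_n (fun l => rho l * logpow' a l v) (k + 1)))).
    + symmetry. rewrite Rmult_plus_distr_l, <- sum_n_scal. f_equal.
      * apply sum_n_ext. intros i. eqR. field. lra.
      * transitivity (/ INR q2 * (Om X * (ap_err r1 q1 v / (v * v))
          - ap_err r1 q1 v / v * sum_n (fun l => rho l * logpow' a l v) (k + 1))).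
        -- eqR. gen_sums. field. lra.
        -- rewrite <- sum_n_scal. unfold Rminus. rewrite Rmult_1_r.
           apply f_equal, f_equal, f_equal, sum_n_ext. intros l. eqR. field. lra.
    + assert (E2 : sum_n (fun i => Binomial.C k i
          * (Z2 (k - i)%nat + Phi (k - i)%nat 1 / INR q2) * logpow' a i v) k
        = sum_n (fun i => Binomial.C k i * logpow' a i v * Z2 (k - i)%nat) k
          + / INR q2 * sum_n (fun i => Binomial.C k i * logpow' a i v * Phi (k - i)%nat 1) k).
      { rewrite <- sum_n_scal, <- sum_n_add. apply sum_n_ext. intros i.
        unfold Rdiv. rring. }
      rewrite E2. eqR. gen_sums. field. split; lra.
  - eapply is_RInt_eqv.
    + apply (is_RInt_plus (V := R_NormedModule)).
      * apply is_RInt_sum_0 with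
          (f := fun i v => Binomial.C k i * (Z2 (k - i)%nat + Phi (k - i)%nat 1 / INR q2)
                           * (logpow' a i v / v * ap_err r1 q1 v)).
        intros i _. apply (is_RInt_scal (V := R_NormedModule)), RI_correct. assumption.
      * apply (is_RInt_scal (V := R_NormedModule)), (is_RInt_minus (V := R_NormedModule)).
        -- apply (is_RInt_scal (V := R_NormedModule)), T_correct. assumption.
        -- apply is_RInt_sum_0 with
             (f := fun l v => rho l * (logpow' a l v / v * ap_err r1 q1 v)).
           intros l _. apply (is_RInt_scal (V := R_NormedModule)), RI_correct. assumption.
    + unfold minus, plus, opp, scal; simpl; unfold mult; simpl. unfold Rdiv. rring.
Qed.


Lemma Om_bound (b : R) :
  b < a -> exists K, forall x, 1 <= x -> Rabs (Om x) <= K * (x * Rpower x (- b)).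
Proof.
  intros Hb.
  destruct (sum_n_bound (fun l x => rho l * logpow' a l x) (fun x => Rpower x (- b))
    (fun x => 1 <= x) (k + 1)) as [K HK].
  - intros l. destruct (logpow'_bound a b l Hb) as [C [HC H]]. exists (Rabs (rho l) * C).
    intros x Hx. rewrite Rabs_mult, Rmult_assoc. apply Rmult_le_compat_l; [ apply Rabs_pos | ].
    now apply H.
  - exists K. intros x Hx. rewrite Om_eq, Rabs_mult, Rabs_right by lra.
    replace (K * (x * Rpower x (- b))) with (x * (K * Rpower x (- b))) by ring.
    apply Rmult_le_compat_l; [ lra | ]. now apply HK.
Qed.

(** [Om] may grow almost like [x ^ (1 - a)], so [f] is required to decay at every rate below [1]. *)
Lemma is_lim_Om_mult (f : R -> R) :
  (forall b, 0 < b < 1 -> exists C, forall x, 1 <= x -> Rabs (f x) <= C * Rpower x (- b)) ->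
  is_lim (fun x => Om x * f x) p_infty 0.
Proof.
  intros Hf. destruct (Om_bound (a / 2)) as [K HK]; [ lra | ].
  (* [Om x] is [O(x ^ (1 - a / 2))], so this rate leaves [x ^ (-a / 4)] for the product. *)
  destruct (Hf (1 - a / 4)) as [C HC]; [ lra | ].
  apply (is_lim_0_of_rate _ (K * C) (a / 4)); [ lra | ].
  intros x Hx. rewrite Rabs_mult.
  replace (K * C * Rpower x (- (a / 4)))
    with (K * (x * Rpower x (- (a / 2))) * (C * Rpower x (- (1 - a / 4)))).
  - apply Rmult_le_compat; [ apply Rabs_pos | apply Rabs_pos | now apply HK | now apply HC ].
  - replace (- (a / 4)) with (1 + (- (a / 2) + - (1 - a / 4))) by field.
    rewrite !Rpower_plus, Rpower_1 by lra. ring.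
Qed.

Lemma is_lim_RI (j : nat) : is_lim (RI j) p_infty (J1 j).
Proof.
  destruct (ap_logsum_asymp a j r1 q1 (Phi j) (a / 2) Hr1 ltac:(lra) (HPhi j)) as [C [_ H]].
  apply (is_lim_of_rate _ _ C (a / 2)); [ lra | ]. intros x Hx. now apply H.
Qed.

Lemma is_lim_S2 (j : nat) : is_lim (fun X => S2 j X - Phi j X / INR q2) p_infty (Z2 j).
Proof.
  destruct (ap_logsum_asymp a j r2 q2 (Phi j) (a / 2) Hr2 ltac:(lra) (HPhi j)) as [C [_ H]].
  apply (is_lim_of_rate _ _ C (a / 2)); [ lra | ]. intros x Hx. now apply H.
Qed.

Lemma is_lim_Om_T :
  is_lim (fun X => Om X * (T X - (gamma_EL 0 r1 q1 - / INR q1))) p_infty 0.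
Proof.
  apply is_lim_Om_mult. intros b Hb.
  destruct (ap_logsum_asymp 1 0 r1 q1 _ b Hr1 ltac:(lra) (is_derive_ln_pow 0))
    as [C [_ H]]. rewrite <- gamma_EL_ap_const in H.
  exists C. intros x Hx. destruct (H x Hx) as [_ H']. rewrite <- Rabs_Ropp.
  replace (- (T x - (gamma_EL 0 r1 q1 - / INR q1))) with
    (RInt (fun u => logpow' 1 0 u / u * ap_err r1 q1 u) 1 x
     - ((logpow 1 0 1 - ln 1 ^ (0 + 1) / INR (0 + 1)) / INR q1 - gamma_EL 0 r1 q1));
    [ exact H' | ].
  unfold T, logpow, Rpower. rewrite ln_1, !Rmult_0_r, exp_0. simpl.
  unfold Rdiv. ring.
Qed.

Lemma is_lim_Om_S :
  is_lim (fun X => Om X * (ap_logsum 1 0 r2 q2 X - ln X / INR q2 - gamma_EL 0 r2 q2))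
    p_infty 0.
Proof.
  apply is_lim_Om_mult. intros b Hb.
  destruct (ap_logsum_asymp 1 0 r2 q2 _ b Hr2 ltac:(lra) (is_derive_ln_pow 0))
    as [C [_ H]]. rewrite <- gamma_EL_ap_const in H.
  exists C. intros x Hx. destruct (H x Hx) as [H' _].
  replace (ln x) with (ln x ^ (0 + 1) / INR (0 + 1)) by (simpl; field). exact H'.
Qed.

(* At the point [v] the error is [O(v ^ (-b) * (X / v) ^ (-b) / v)], which is
   [X ^ (-b) / v] and integrates to [X ^ (-b) * ln X]. *)
Lemma inner_integral_lim (W : R -> R) :
  (forall X, 1 <= X -> is_RInt (fun v => ap_err r1 q1 v / v
      * sum_n (fun i => Binomial.C k i * logpow' a i v * S2 (k - i)%nat (X / v)) k)
    1 X (W X)) ->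
  is_lim (fun X => W X
    - (sum_n (fun i => Binomial.C k i * (Z2 (k - i)%nat + Phi (k - i)%nat 1 / INR q2) * RI i X) k
       + (Om X * T X - sum_n (fun l => rho l * RI l X) (k + 1)) / INR q2)) p_infty 0.
Proof.
  intros HW. set (b := a / 2).
  (* The bound must be uniform in [v], which is integrated up to [X]; it is therefore stated for
     pairs [(X, v)]. *)
  destruct (sum_n_bound (T := R * R)
    (fun i p => Binomial.C k i * logpow' a i (snd p)
       * (S2 (k - i)%nat (fst p / snd p)
          - (Phi (k - i)%nat (fst p / snd p) / INR q2 + Z2 (k - i)%nat)))
    (fun p => Rpower (fst p) (- b)) (fun p => 1 <= snd p <= fst p) k) as [K HK].
  { intros i. destruct (logpow'_bound a b i) as [C1 [HC1 H1]]; [ unfold b; lra | ].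
    destruct (ap_logsum_asymp a (k - i) r2 q2 (Phi (k - i)%nat) b Hr2
      ltac:(unfold b; lra) (HPhi (k - i)%nat)) as [C2 [HC2 H2]].
    exists (Rabs (Binomial.C k i) * C1 * C2). intros [X v] Hp. simpl in Hp |- *.
    assert (HXv : 1 <= X / v) by (apply Rle_div_r; lra).
    destruct (H2 (X / v) HXv) as [H2' _]. specialize (H1 v ltac:(lra)).
    fold (S2 (k - i)%nat (X / v)) (Z2 (k - i)%nat) in H2'.
    rewrite !Rabs_mult.
    replace (Rpower X (- b)) with (Rpower v (- b) * Rpower (X / v) (- b)).
    - replace (Rabs (Binomial.C k i) * C1 * C2 * (Rpower v (- b) * Rpower (X / v) (- b)))
        with (Rabs (Binomial.C k i) * (C1 * Rpower v (- b)) * (C2 * Rpower (X / v) (- b)))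
        by ring.
      apply Rmult_le_compat.
      + apply Rmult_le_pos; apply Rabs_pos.
      + apply Rabs_pos.
      + apply Rmult_le_compat_l; [ apply Rabs_pos | assumption ].
      + rewrite Rminus_plus_distr. exact H2'.
    - rewrite Rpower_mult_distr by lra. f_equal. field. lra. }
  (* Half of the exponent is given up to absorb the factor [ln X]. *)
  destruct (logpow_bound b (b / 2) 1) as [C [HC Hln]]; [ unfold b; lra | ].
  apply (is_lim_0_of_rate _ (2 * Rabs K * C) (b / 2)); [ unfold b; lra | ].
  intros X HX.
  pose proof (is_RInt_minus (V := R_NormedModule) _ _ _ _ _ _
    (HW X HX) (inner_integral_main X HX)) as HI.
  apply Rle_trans with (2 * Rabs K * Rpower X (- b) * (ln X - ln 1)).
  - refine (norm_RInt_le (V := R_NormedModule) _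
      (fun v => 2 * Rabs K * Rpower X (- b) * / v) 1 X _ _ HX _ HI _).
    + intros v Hv. unfold norm; simpl; unfold abs, minus, plus, opp; simpl.
      specialize (HK (X, v) Hv). cbn [fst snd] in HK.
      match goal with |- Rabs (?e * ?s1 + - (?e * ?s2)) <= _ =>
        replace (e * s1 + - (e * s2)) with (e * (s1 + -1 * s2)) by rring end.
      rewrite <- sum_n_scal, <- sum_n_add, Rabs_mult.
      replace (2 * Rabs K * Rpower X (- b) * / v)
        with (2 * / v * (Rabs K * Rpower X (- b))) by ring.
      apply Rmult_le_compat; [ apply Rabs_pos | apply Rabs_pos | | ].
      * unfold Rdiv. rewrite Rabs_mult, (Rabs_right (/ v))
          by (left; apply Rinv_0_lt_compat; lra).
        apply Rmult_le_compat_r; [ left; apply Rinv_0_lt_compat; lra | ].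
        apply ap_err_bound; [ assumption | lra ].
      * eapply Rle_trans; [ | eapply Rle_trans; [ exact HK | ] ].
        -- right. f_equal. apply sum_n_ext. intros i. rring.
        -- apply Rmult_le_compat_r; [ left; apply Rpower_pos | apply Rle_abs ].
    + apply (is_RInt_scal (V := R_NormedModule)), is_RInt_FTC; [ assumption | | ].
      * intros u Hu. apply is_derive_ln. lra.
      * intros u Hu. apply continuous_Rinv. lra.
  - rewrite ln_1, Rminus_0_r. specialize (Hln X HX). unfold logpow in Hln.
    rewrite pow_1, Rabs_right in Hln
      by (apply Rle_ge, Rmult_le_pos; [ now apply ln_nonneg | left; apply Rpower_pos ]).
    pose proof (Rabs_pos K). nra.
Qed.

(** By parts against [Om], the remaining integrand is [Om x / x] divided by [q1 * q2]. By [Hrho]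
    this involves only [logpow a k] and the [rho l * logpow a l], whose antiderivatives are the
    [Phi]. *)
Lemma main_term_integral (X : R) :
  1 <= X ->
  is_RInt (fun x => - logpow' a k x / x * main_term r1 q1 r2 q2 x) 1 X
    ((Phi k X - sum_n (fun l => rho l * Phi l X) (k + 1)) / (INR q1 * INR q2)
     - Om X * (ln X / (INR q1 * INR q2) + G - 1 / (INR q1 * INR q2))
     - ((Phi k 1 - sum_n (fun l => rho l * Phi l 1) (k + 1)) / (INR q1 * INR q2)
        - Om 1 * (G - 1 / (INR q1 * INR q2)))).
Proof.
  intros HX.
  assert (Hq1 : 0 < INR q1) by (apply lt_0_INR; lia).
  assert (Hq2 : 0 < INR q2) by (apply lt_0_INR; lia).
  set (F := fun X => / (INR q1 * INR q2)
      * (Phi k X - sum_n (fun l => rho l * Phi l X) (k + 1))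
    - Om X * (/ (INR q1 * INR q2) * ln X + (G - 1 / (INR q1 * INR q2)))).
  apply is_RInt_eqv with (F X - F 1).
  2: { unfold F. rewrite ln_1. eqR. gen_sums. field. lra. }
  apply is_RInt_FTC; [ assumption | | ].
  - intros u Hu. unfold F. evar_last.
    + apply (is_derive_minus (fun X => / (INR q1 * INR q2)
        * (Phi k X - sum_n (fun l => rho l * Phi l X) (k + 1)))).
      * apply (is_derive_scal (fun X => Phi k X - sum_n (fun l => rho l * Phi l X) (k + 1))).
        apply (is_derive_minus (Phi k)); [ apply HPhi; lra | ].
        apply (is_derive_sum_n (fun l X => rho l * Phi l X) (k + 1) u
          (fun l => rho l * logpow a l u)).
        intros l _. apply (is_derive_scal (Phi l)), HPhi. lra.
      * apply (is_derive_mult Om); [ apply is_derive_Om; lra | | intros; apply Rmult_comm ].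
        apply (is_derive_plus (fun X => / (INR q1 * INR q2) * ln X)).
        -- apply (is_derive_scal ln). apply is_derive_ln. lra.
        -- apply (is_derive_const (K := R_AbsRing)).
    + unfold minus, plus, opp, scal, zero; simpl. unfold mult; simpl.
      unfold main_term, G, Om. rewrite (Hrho u) by lra.
      eqR. gen_sums. field. lra.
  - intros u Hu. apply (continuous_mult (fun x => - logpow' a k x / x)).
    + apply (continuous_mult (fun x => - logpow' a k x)).
      * apply (continuous_opp (logpow' a k)), continuous_logpow'. lra.
      * apply continuous_Rinv. lra.
    + apply (ex_derive_continuous (V := R_NormedModule)). unfold main_term. auto_derive. lra.
Qed.

Lemma integral_main :
  exists V : R -> R,
    (forall X, 1 <= X ->
      is_RInt (fun x => - logpow' a k x / x
        * (sum_upto (fun n => INR (dstar r1 q1 r2 q2 n)) x - main_term r1 q1 r2 q2 x))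
        1 X (V X)) /\
    is_lim V p_infty integral_limit.
Proof.
  assert (Hq1 : 0 < INR q1) by (apply lt_0_INR; lia).
  assert (Hq2 : 0 < INR q2) by (apply lt_0_INR; lia).
  set (w := fun X v => ap_err r1 q1 v / v
      * sum_n (fun i => Binomial.C k i * logpow' a i v * S2 (k - i)%nat (X / v)) k).
  set (W := fun X => RInt (w X) 1 X).
  assert (HW : forall X, 1 <= X -> is_RInt (w X) 1 X (W X) /\
    is_RInt (fun x => - logpow' a k x / x
      * sum_upto (fun n => INR (dstar r1 q1 r2 q2 n)) x) 1 X
    (- W X - (Om X * ap_logsum 1 0 r2 q2 X
              - (S2 k X - sum_n (fun l => rho l * S2 l X) (k + 1))) / INR q1)).
  { intros X HX.
    destruct (dstar_integral a k r1 q1 r2 q2 Om X Hr1 HX is_derive_Om) as [W' [H1 H2]].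
    change (is_RInt (w X) 1 X W') in H1.
    assert (E : W X = W') by exact (is_RInt_unique _ _ _ _ H1).
    rewrite E. split; [ exact H1 | ].
    apply is_RInt_eqv with (1 := H2). apply f_equal.
    apply (f_equal (fun s => s / INR q1)).
    unfold S2, ap_logsum, sum_upto. set (m := Z.to_nat (Int_part X)).
    (* By [Hrho], [Om b / b] is [logpow a k b] minus the sum of the [rho l * logpow a l b], so every
       sum over [b] is an [ap_logsum]; [Om X / b] gives the one with exponent [1]. *)
    transitivity (sum_n_m (fun b => Om X * (ap_ind r2 q2 b * logpow 1 0 (INR b))
      + (-1 * (ap_ind r2 q2 b * logpow a k (INR b))
         + sum_n (fun l => rho l * (ap_ind r2 q2 b * logpow a l (INR b))) (k + 1))) 1 m).
    - apply sum_n_m_ext_loc. intros b Hb.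
      assert (Hb' : 0 < INR b) by (apply lt_0_INR; lia).
      transitivity (Om X * (ap_ind r2 q2 b * logpow 1 0 (INR b))
        + (-1 * (ap_ind r2 q2 b * logpow a k (INR b))
           + ap_ind r2 q2 b * sum_n (fun l => rho l * logpow a l (INR b)) (k + 1))).
      + unfold Om at 2. rewrite (Hrho (INR b)) by assumption.
        replace (logpow 1 0 (INR b)) with (/ INR b)
          by (unfold logpow; rewrite Rpower_Ropp, Rpower_1 by assumption; simpl; ring).
        eqR. gen_sums. field. lra.
      + f_equal. f_equal. rewrite <- sum_n_scal. apply sum_n_ext. intros l. rring.
    - rewrite !sum_1_plus, !sum_1_scal, <- sum_n_sum_1_switch.
      transitivity (Om X * sum_n_m (fun n => ap_ind r2 q2 n * logpow 1 0 (INR n)) 1 m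
        + (-1 * sum_n_m (fun n => ap_ind r2 q2 n * logpow a k (INR n)) 1 m
           + sum_n (fun l => rho l * sum_n_m (fun n => ap_ind r2 q2 n * logpow a l (INR n)) 1 m)
               (k + 1))).
      + f_equal. f_equal. apply sum_n_ext. intros l. now rewrite sum_1_scal.
      + rring. }
  exists (fun X => - W X - (Om X * ap_logsum 1 0 r2 q2 X
              - (S2 k X - sum_n (fun l => rho l * S2 l X) (k + 1))) / INR q1
    - ((Phi k X - sum_n (fun l => rho l * Phi l X) (k + 1)) / (INR q1 * INR q2)
     - Om X * (ln X / (INR q1 * INR q2) + G - 1 / (INR q1 * INR q2))
     - ((Phi k 1 - sum_n (fun l => rho l * Phi l 1) (k + 1)) / (INR q1 * INR q2)
        - Om 1 * (G - 1 / (INR q1 * INR q2))))).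
  split.
  - intros X HX.
    apply is_RInt_ext with (fun x => minus
      (- logpow' a k x / x * sum_upto (fun n => INR (dstar r1 q1 r2 q2 n)) x)
      (- logpow' a k x / x * main_term r1 q1 r2 q2 x)).
    + intros x _. unfold minus, plus, opp; simpl. unfold sum_upto. rring.
    + apply (is_RInt_minus (V := R_NormedModule)).
      * now apply HW.
      * now apply main_term_integral.
  - pose proof (inner_integral_lim W (fun X HX => proj1 (HW X HX))) as L1.
    pose proof is_lim_Om_T as L2. pose proof is_lim_Om_S as L3.
    pose proof (is_lim_S2 k) as L4.
    assert (L5 : is_lim (fun X => sum_n (fun l => rho l * (S2 l X - Phi l X / INR q2)) (k + 1))
      p_infty (sum_n (fun l => rho l * Z2 l) (k + 1))).
    { apply (is_lim_sum_n (fun l X => rho l * (S2 l X - Phi l X / INR q2))).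
      intros l _. apply (is_lim_scal_l _ (rho l) p_infty (Z2 l)), is_lim_S2. }
    assert (L6 : is_lim (fun X => sum_n (fun i => Binomial.C k i
        * (Z2 (k - i)%nat + Phi (k - i)%nat 1 / INR q2) * RI i X) k) p_infty
      (sum_n (fun i => Binomial.C k i
        * (Z2 (k - i)%nat + Phi (k - i)%nat 1 / INR q2) * J1 i) k)).
    { apply (is_lim_sum_n (fun i X => Binomial.C k i
        * (Z2 (k - i)%nat + Phi (k - i)%nat 1 / INR q2) * RI i X)).
      intros i _. apply (is_lim_scal_l (RI i) _ p_infty (J1 i)), is_lim_RI. }
    assert (L7 : is_lim (fun X => sum_n (fun l => rho l * RI l X) (k + 1)) p_infty
      (sum_n (fun l => rho l * J1 l) (k + 1))).
    { apply (is_lim_sum_n (fun l X => rho l * RI l X)).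
      intros l _. apply (is_lim_scal_l (RI l) _ p_infty (J1 l)), is_lim_RI. }
    set (c := (Phi k 1 - sum_n (fun l => rho l * Phi l 1) (k + 1)) / (INR q1 * INR q2)
      - Om 1 * (G - 1 / (INR q1 * INR q2))) in *.
    (* [M1] and [M2] pair each growing quantity with its own main term, so that each bracket has a
       finite limit. *)
    assert (M1 : is_lim (fun X => / INR q1 * ((S2 k X - Phi k X / INR q2)
        - sum_n (fun l => rho l * (S2 l X - Phi l X / INR q2)) (k + 1)
        - Om X * (ap_logsum 1 0 r2 q2 X - ln X / INR q2 - gamma_EL 0 r2 q2))) p_infty
      (/ INR q1 * (Z2 k - sum_n (fun l => rho l * Z2 l) (k + 1) - 0))).
    { apply (is_lim_scal_l _ (/ INR q1) p_infty
        (Finite (Z2 k - sum_n (fun l => rho l * Z2 l) (k + 1) - 0))).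
      apply is_lim_minus'; [ now apply is_lim_minus' | exact L3 ]. }
    assert (M2 : is_lim (fun X => / INR q2 * (sum_n (fun l => rho l * RI l X) (k + 1)
        - Om X * (T X - (gamma_EL 0 r1 q1 - / INR q1)))) p_infty
      (/ INR q2 * (sum_n (fun l => rho l * J1 l) (k + 1) - 0))).
    { apply (is_lim_scal_l _ (/ INR q2) p_infty
        (Finite (sum_n (fun l => rho l * J1 l) (k + 1) - 0))).
      now apply is_lim_minus'. }
    pose proof (is_lim_plus' _ _ _ _ _ (is_lim_minus' _ _ _ _ _
      (is_lim_minus' _ _ _ _ _ (is_lim_plus' _ _ _ _ _ M1 M2) L1) L6)
      (is_lim_const c p_infty)) as L.
    match type of L with is_lim _ _ (Finite ?l) => replace integral_limit with l end.
    (* The main terms inserted in [M1] and [M2] add up exactly to the upper end point of the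
       integral of [main_term], so this is an identity for every [X]. *)
    + revert L. apply is_lim_ext. intros X.
      assert (E : sum_n (fun l => rho l * (S2 l X - Phi l X / INR q2)) (k + 1)
        = sum_n (fun l => rho l * S2 l X) (k + 1)
          + - / INR q2 * sum_n (fun l => rho l * Phi l X) (k + 1)).
      { rewrite <- sum_n_scal, <- sum_n_add. apply sum_n_ext. intros l.
        unfold Rdiv. rring. }
      rewrite E. unfold c, G. eqR. gen_sums. field. lra.
    + unfold integral_limit, c. eqR. gen_sums. field. lra.
Qed.

End RegularizedIntegral.

(** * Evaluating the limit in the two cases *)

Lemma is_int_1_infty_of_lim (f V : R -> R) (l : R) :
  (forall X, 1 <= X -> is_RInt f 1 X (V X)) -> is_lim V p_infty l -> is_int_1_infty f l.
Proof.
  intros Hf HV P HP. specialize (HV P HP). destruct HV as [M HM].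
  apply (Filter_prod _ _ _ (fun x => x = 1) (fun y => Rmax M 1 < y)).
  - reflexivity.
  - now exists (Rmax M 1).
  - intros x y -> Hy. simpl. pose proof (Rmax_l M 1). pose proof (Rmax_r M 1).
    exists (V y). split; [ apply Hf; lra | apply HM; lra ].
Qed.

Lemma is_int_1_infty_ext (f g : R -> R) (l : R) :
  (forall x, 1 <= x -> f x = g x) -> is_int_1_infty f l -> is_int_1_infty g l.
Proof.
  intros Hfg. apply (is_RInt_gen_ext (V := R_NormedModule)).
  apply (Filter_prod _ _ _ (fun x => x = 1) (fun y => 1 < y)).
  - reflexivity.
  - now exists 1.
  - intros x y -> Hy z. simpl. rewrite Rmin_left by lra. intros Hz. apply Hfg. lra.
Qed.

(** Origin of the floor in the theorem: it is [ln 1 ^ k], with [0 ^ 0 = 1], and the quotient is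
    division in [nat]. *)
Lemma logpow_at_1 (a : R) (k : nat) : logpow a k 1 = INR (1 / (k + 1)).
Proof.
  unfold logpow, Rpower. rewrite ln_1, Rmult_0_r, exp_0.
  destruct k as [ | k ].
  - simpl. ring.
  - rewrite Nat.div_small by lia. simpl. ring.
Qed.

Lemma sum_n_head (f : nat -> R) (n : nat) : (forall i, f (S i) = 0) -> sum_n f n = f 0%nat.
Proof.
  intros H. induction n as [ | n IH ]; [ apply sum_O | ].
  transitivity (sum_n f n + f (S n)); [ apply (sum_Sn (G := R_AbelianMonoid)) | ].
  rewrite IH, H. rring.
Qed.

Lemma sum_n_rev (f : nat -> R) (n : nat) : sum_n (fun i => f (n - i)%nat) n = sum_n f n.
Proof.
  induction n as [ | n IH ]; [ now rewrite !sum_O | ].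
  rewrite (sum_Sn f n), <- IH. unfold sum_n. rewrite sum_Sn_m by lia.
  rewrite <- sum_n_m_S. change (plus ?x ?y) with (x + y). rewrite Rplus_comm. reflexivity.
Qed.

Lemma binomial_sum_rev (u v : nat -> R) (k : nat) :
  sum_n (fun i => Binomial.C k i * u (k - i)%nat * v i) k
  = sum_n (fun i => Binomial.C k i * v (k - i)%nat * u i) k.
Proof.
  rewrite <- sum_n_rev. apply sum_n_ext_loc. intros i Hi.
  rewrite <- pascal_step1 by lia.
  replace (k - (k - i))%nat with i by lia. rring.
Qed.

(** The recursion of integration by parts. The derivative, the value at [1] and the expansion in
    [logpow] follow from it by induction. *)
Lemma I_main_S (k : nat) (x a : R) :
  a <> 1 ->
  I_main (S k) x a = Rpower x (1 - a) * ln x ^ S k / (1 - a)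
                     - INR (S k) / (1 - a) * I_main k x a.
Proof.
  intros Ha. unfold I_main, sum_n. rewrite sum_Sn_m by lia. rewrite <- sum_n_m_S.
  change (plus ?x ?y) with (x + y).
  transitivity (Rpower x (1 - a) * (ln x ^ S k / (1 - a)
    + - INR (S k) / (1 - a) * sum_n (fun i => (-1) ^ i * (INR (fact k) / INR (fact (k - i)))
                  * (ln x ^ (k - i) / (1 - a) ^ (i + 1))) k)).
  - apply f_equal, (f_equal2 Rplus).
    + rewrite Nat.sub_0_r. pose proof (INR_fact_neq_0 (S k)). simpl (0 + 1)%nat.
      rewrite pow_1. change ((-1) ^ 0) with 1. field. split; lra.
    + rewrite <- sum_n_scal. apply sum_n_ext. intros i.
      change (S k - S i)%nat with (k - i)%nat. pose proof (INR_fact_neq_0 (k - i)).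
      assert ((1 - a) ^ (i + 1) <> 0) by (apply pow_nonzero; lra).
      change (S i + 1)%nat with (S (i + 1)). rewrite <- (tech_pow_Rmult (1 - a)).
      rewrite <- (tech_pow_Rmult (-1)), fact_simpl, mult_INR. eqR. field.
      repeat split; assumption || lra.
  - unfold sum_n. eqR. gen_sums. field. lra.
Qed.

Lemma I_main_0 (x a : R) : a <> 1 -> I_main 0 x a = Rpower x (1 - a) / (1 - a).
Proof. intros Ha. unfold I_main. rewrite sum_O. simpl. field. lra. Qed.

Lemma Rpower_1_minus (x a : R) : 0 < x -> Rpower x (1 - a) = x * Rpower x (- a).
Proof. intros Hx. unfold Rminus. now rewrite Rpower_plus, Rpower_1. Qed.

Lemma is_derive_I_main (k : nat) (x a : R) :
  a <> 1 -> 0 < x -> is_derive (fun x => I_main k x a) x (logpow a k x).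
Proof.
  intros Ha Hx. induction k as [ | k IH ].
  - apply is_derive_ext with (fun x => / (1 - a) * Rpower x (1 - a)).
    + intros t. rewrite I_main_0 by assumption. unfold Rdiv. apply Rmult_comm.
    + evar_last; [ apply is_derive_scal; now apply is_derive_Rpower | ].
      rewrite Rpower_1_minus by assumption. unfold logpow. simpl. field. lra.
  - apply is_derive_ext with (fun x => / (1 - a) * (Rpower x (1 - a) * ln x ^ S k)
      - INR (S k) / (1 - a) * I_main k x a).
    + intros t. rewrite I_main_S by assumption. eqR; field; lra.
    + evar_last.
      * apply (is_derive_minus (fun x => / (1 - a) * (Rpower x (1 - a) * ln x ^ S k))).
        -- apply is_derive_scal. apply (is_derive_mult (fun x => Rpower x (1 - a))).
           ++ now apply is_derive_Rpower.
           ++ apply is_derive_pow. now apply is_derive_ln.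
           ++ intros; apply Rmult_comm.
        -- apply (is_derive_scal (fun x => I_main k x a)). exact IH.
      * rewrite Rpower_1_minus by assumption.
        unfold minus, plus, opp, mult; simpl Nat.pred; cbn -[INR pow].
        unfold logpow. rewrite <- (tech_pow_Rmult (ln x) k). field. lra.
Qed.

Lemma I_main_at_1 (k : nat) (a : R) :
  a <> 1 -> I_main k 1 a = - (INR (fact k) / (a - 1) ^ (k + 1)).
Proof.
  intros Ha. induction k as [ | k IH ].
  - rewrite I_main_0 by assumption. unfold Rpower. rewrite ln_1, Rmult_0_r, exp_0.
    simpl. field. lra.
  - rewrite I_main_S, IH, ln_1 by assumption.
    assert ((a - 1) ^ (k + 1) <> 0) by (apply pow_nonzero; lra).
    change (S k + 1)%nat with (S (k + 1)).
    rewrite <- (tech_pow_Rmult (a - 1)), fact_simpl, mult_INR.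
    rewrite (pow_i (S k)) by lia. field. repeat split; assumption || lra.
Qed.

(** Provides [rho] below exponent 1. At [x = 1] the recursion loses its logarithmic term, so the
    value at index [k + 1 - l] is that at [k - l] times [-(k + 1 - l) / (1 - a)]; the factor
    [k + 1 - l] turns the binomials of [k + 1] into [k + 1] times those of [k]. *)
Lemma I_main_logpow (k : nat) (x a : R) :
  a <> 1 -> 0 < x ->
  I_main k x a
  = x * sum_n (fun l => Binomial.C k l * I_main (k - l) 1 a * logpow a l x) k.
Proof.
  intros Ha Hx.
  assert (HC : forall n, Binomial.C n n = 1).
  { intros n. unfold Binomial.C. rewrite Nat.sub_diag. simpl. field. apply INR_fact_neq_0. }
  induction k as [ | k IH ].
  - rewrite sum_O, HC, !I_main_0, Rpower_1_minus by assumption.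
    unfold logpow, Rpower. rewrite ln_1, Rmult_0_r, exp_0. simpl. field. lra.
  - rewrite I_main_S, IH, sum_Sn, HC, Nat.sub_diag, I_main_0, Rpower_1_minus by assumption.
    change (plus ?x ?y) with (x + y).
    transitivity (x * (- INR (S k) / (1 - a)
        * sum_n (fun l => Binomial.C k l * I_main (k - l) 1 a * logpow a l x) k
      + 1 * (Rpower 1 (1 - a) / (1 - a)) * logpow a (S k) x)).
    + replace (Rpower 1 (1 - a)) with 1
        by (unfold Rpower; rewrite ln_1, Rmult_0_r; symmetry; apply exp_0).
      unfold logpow.
      eqR. gen_sums. field. lra.
    + apply f_equal, (f_equal2 Rplus); [ | reflexivity ].
      rewrite <- sum_n_scal. apply sum_n_ext_loc. intros l Hl.
      replace (S k - l)%nat with (S (k - l)) by lia.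
      rewrite I_main_S, ln_1, pow_i by (assumption || lia).
      unfold Binomial.C. replace (S k - l)%nat with (S (k - l)) by lia.
      rewrite !fact_simpl, !mult_INR.
      pose proof (INR_fact_neq_0 l). pose proof (INR_fact_neq_0 (k - l)).
      assert (INR (S (k - l)) <> 0) by (apply not_0_INR; lia).
      eqR. field. repeat split; assumption || lra.
Qed.

(** At exponent 1, [rho] has a single nonzero entry, at [k + 1]; below 1 its entries stop at [k].
    The common length [k + 1] accommodates both. *)
Lemma sum_n_last (k : nat) (c : R) (f : nat -> R) :
  sum_n (fun l => (if Nat.eqb l (k + 1) then c else 0) * f l) (k + 1) = c * f (k + 1)%nat.
Proof.
  rewrite Nat.add_1_r, sum_Sn, Nat.eqb_refl.
  rewrite (sum_n_ext_loc _ (fun l => 0 * f l)).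
  - rewrite sum_n_scal. change (plus ?x ?y) with (x + y). rring.
  - intros l Hl. destruct (Nat.eqb_spec l (S k)); [ lia | reflexivity ].
Qed.

Lemma sum_n_up_to (k : nat) (c f : nat -> R) :
  sum_n (fun l => (if Nat.leb l k then c l else 0) * f l) (k + 1)
  = sum_n (fun l => c l * f l) k.
Proof.
  rewrite Nat.add_1_r, sum_Sn.
  rewrite (sum_n_ext_loc _ (fun l => c l * f l)).
  - replace (S k <=? k)%nat with false by (symmetry; apply Nat.leb_gt; lia).
    change (plus ?x ?y) with (x + y). rring.
  - intros l Hl. now replace (l <=? k)%nat with true by (symmetry; apply Nat.leb_le; lia).
Qed.

Lemma binomial_sum_logpow_at_1 (a : R) (k : nat) (u : nat -> R) :
  sum_n (fun i => Binomial.C k i * u (k - i)%nat * logpow a i 1) k = u k.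
Proof.
  rewrite sum_n_head.
  - unfold logpow, Rpower. rewrite ln_1, Rmult_0_r, exp_0, Nat.sub_0_r, pascal_step1 by lia.
    rewrite Nat.sub_0_r. unfold Binomial.C. rewrite Nat.sub_diag. simpl. field.
    apply INR_fact_neq_0.
  - intros i. unfold logpow. rewrite ln_1, pow_i by lia. ring.
Qed.

(** Each of the [k + 1] terms equals [k! * c * d]. *)
Lemma binomial_sum_fact (k : nat) (c d : R) :
  sum_n (fun l => Binomial.C k l * (INR (fact (k - l)) * c) * (INR (fact l) * d)) k
  = INR (fact (k + 1)) * c * d.
Proof.
  rewrite (sum_n_ext_loc _ (fun _ => INR (fact k) * c * d)).
  - rewrite sum_n_const, Nat.add_1_r, fact_simpl, mult_INR. rring.
  - intros l Hl. unfold Binomial.C.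
    pose proof (INR_fact_neq_0 l). pose proof (INR_fact_neq_0 (k - l)).
    eqR. field. split; assumption.
Qed.

(** All [Phi j 1] vanish with [ln 1]. In the product sum only [i = 0] meets a nonzero
    [logpow 1 i 1], and this cancels the isolated [gamma_EL k r2 q2 / INR q1]; the single entry of
    [rho] yields the constants of index [k + 1]. *)
Lemma integral_limit_1 (k r1 q1 r2 q2 : nat) :
  (1 <= q1)%nat -> (1 <= q2)%nat ->
  integral_limit 1 k r1 q1 r2 q2 (fun j x => ln x ^ (j + 1) / INR (j + 1))
    (fun l => if Nat.eqb l (k + 1) then / INR (k + 1) else 0)
  = sum_n (fun i => Binomial.C k i * gamma_EL (k - i) r2 q2 * gamma_EL i r1 q1) k
     + INR (1 / (k + 1))
       * (1 / (INR q1 * INR q2) - gamma_EL 0 r1 q1 / INR q2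
          - gamma_EL 0 r2 q2 / INR q1)
     - gamma_EL (k + 1) r2 q2 / (INR q1 * INR (k + 1))
     - gamma_EL (k + 1) r1 q1 / (INR q2 * INR (k + 1)).
Proof.
  intros Hq1 Hq2. unfold integral_limit. rewrite !sum_n_last.
  assert (INR q1 <> 0) by (apply not_0_INR; lia).
  assert (INR q2 <> 0) by (apply not_0_INR; lia).
  assert (INR (k + 1) <> 0) by (apply not_0_INR; lia).
  assert (E0 : forall j, ln 1 ^ (j + 1) / INR (j + 1) = 0).
  { intros j. rewrite ln_1, pow_i by lia. unfold Rdiv. ring. }
  rewrite <- !gamma_EL_ap_const, !E0.
  rewrite (sum_n_ext _ (fun i => / INR q1
      * (Binomial.C k i * gamma_EL (k - i) r2 q2 * logpow 1 i 1)
    + -1 * (Binomial.C k i * gamma_EL (k - i) r2 q2 * gamma_EL i r1 q1))).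
  2: { intros i. rewrite !E0, <- !gamma_EL_ap_const. eqR. field. split; assumption. }
  rewrite sum_n_add, !sum_n_scal.
  rewrite (binomial_sum_logpow_at_1 1 k (fun j => gamma_EL j r2 q2)).
  rewrite <- (logpow_at_1 1 k).
  replace (logpow 1 (k + 1) 1) with 0.
  - eqR. gen_sums. field. repeat split; assumption.
  - unfold logpow. rewrite ln_1, pow_i by lia. ring.
Qed.

(** Here the values [p j] of [I_main] at [1] do not vanish. The sums [A1] and [A2], which mix them
    with constants, cancel; [Ap], a product of such values alone, gives the factor [(k + 1)!], and
    [p k] times the gamma_0 gives the last term. The binomials in [S] are those of
    [(ln u + ln v) ^ k], as in the case of exponent 1. *)
Lemma integral_limit_lt_1 (a : R) (k r1 q1 r2 q2 : nat) :
  a <> 1 -> (1 <= q1)%nat -> (1 <= q2)%nat ->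
  integral_limit a k r1 q1 r2 q2 (fun j x => I_main j x a)
    (fun l => if Nat.leb l k then Binomial.C k l * I_main (k - l) 1 a else 0)
  = sum_n (fun l => Binomial.C k l * zeta_const l a r1 q1
                     * zeta_const (k - l) a r2 q2) k
     + INR (1 / (k + 1))
       * (1 / (INR q1 * INR q2) - gamma_EL 0 r1 q1 / INR q2
          - gamma_EL 0 r2 q2 / INR q1)
     - 1 / (INR q1 * INR q2) * (INR (fact (k + 1)) / (a - 1) ^ (k + 2))
     - (gamma_EL 0 r1 q1 / INR q2 + gamma_EL 0 r2 q2 / INR q1)
       * (INR (fact k) / (a - 1) ^ (k + 1)).
Proof.
  intros Ha Hq1 Hq2. unfold integral_limit. rewrite !sum_n_up_to.
  assert (INR q1 <> 0) by (apply not_0_INR; lia).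
  assert (INR q2 <> 0) by (apply not_0_INR; lia).
  assert (H1a : a - 1 <> 0) by lra.
  set (z1 := fun j => zeta_const j a r1 q1). set (z2 := fun j => zeta_const j a r2 q2).
  set (p := fun j => I_main j 1 a).
  set (Ap := sum_n (fun l => Binomial.C k l * p (k - l)%nat * p l) k).
  set (A1 := sum_n (fun l => Binomial.C k l * p (k - l)%nat
    * ((logpow a l 1 - p l) / INR q1 - z1 l)) k).
  set (A2 := sum_n (fun l => Binomial.C k l * p (k - l)%nat * z2 l) k).
  set (S := sum_n (fun l => Binomial.C k l * z1 l * z2 (k - l)%nat) k).
  assert (EAp : Ap = INR (fact (k + 1)) / (a - 1) ^ (k + 2)).
  { unfold Ap, p.
    rewrite (sum_n_ext_loc _ (fun l => / (a - 1) ^ (k + 2)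
      * (Binomial.C k l * (INR (fact (k - l)) * 1) * (INR (fact l) * 1)))).
    - rewrite sum_n_scal, binomial_sum_fact. unfold Rdiv. rring.
    - intros l Hl. rewrite !I_main_at_1 by assumption.
      replace (k + 2)%nat with ((k - l + 1) + (l + 1))%nat by lia.
      rewrite (pow_add (a - 1) (k - l + 1)). eqR. field.
      split; apply pow_nonzero; assumption. }
  assert (E1 : sum_n (fun i => Binomial.C k i
      * (ap_const a (k - i) r2 q2 (fun x => I_main (k - i) x a) + I_main (k - i) 1 a / INR q2)
      * ((logpow a i 1 - I_main i 1 a) / INR q1
         - ap_const a i r1 q1 (fun x => I_main i x a))) k
    = / INR q1 * z2 k - / INR q1 * A2 - S + / INR q2 * A1).
  { rewrite <- (binomial_sum_logpow_at_1 a k z2) at 1. unfold A1, A2, S.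
    rewrite (binomial_sum_rev p z2).
    transitivity (sum_n (fun i =>
      / INR q1 * (Binomial.C k i * z2 (k - i)%nat * logpow a i 1)
      + (- / INR q1 * (Binomial.C k i * z2 (k - i)%nat * p i)
      + (-1 * (Binomial.C k i * z1 i * z2 (k - i)%nat)
      + / INR q2 * (Binomial.C k i * p (k - i)%nat
          * ((logpow a i 1 - p i) / INR q1 - z1 i))))) k).
    - apply sum_n_ext. intros i. rewrite <- !zeta_const_ap_const.
      fold (z1 i) (z2 (k - i)%nat) (p i) (p (k - i)%nat). eqR. field. split; assumption.
    - rewrite !sum_n_add, !sum_n_scal. rring. }
  rewrite E1.
  rewrite (sum_n_ext (fun l => Binomial.C k l * I_main (k - l) 1 a
      * ap_const a l r2 q2 (fun x => I_main l x a))
    (fun l => Binomial.C k l * p (k - l)%nat * z2 l))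
    by (intros l; now rewrite <- zeta_const_ap_const).
  rewrite (sum_n_ext (fun l => Binomial.C k l * I_main (k - l) 1 a
      * ((logpow a l 1 - I_main l 1 a) / INR q1 - ap_const a l r1 q1 (fun x => I_main l x a)))
    (fun l => Binomial.C k l * p (k - l)%nat * ((logpow a l 1 - p l) / INR q1 - z1 l)))
    by (intros l; now rewrite <- zeta_const_ap_const).
  fold A1 A2.
  change (sum_n (fun l => Binomial.C k l * I_main (k - l) 1 a * I_main l 1 a) k) with Ap.
  change (sum_n (fun l => Binomial.C k l * zeta_const l a r1 q1
    * zeta_const (k - l) a r2 q2) k) with S.
  rewrite EAp, <- zeta_const_ap_const, I_main_at_1, (logpow_at_1 a k) by assumption.
  fold (z2 k). clearbody A1 A2 S z2. clear - H H0 H1a.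
  assert ((a - 1) ^ (k + 1) <> 0) by now apply pow_nonzero.
  assert ((a - 1) ^ (k + 2) <> 0) by now apply pow_nonzero.
  eqR. field. repeat split; assumption.
Qed.

Theorem theorem3 :
  forall r1 q1 r2 q2 : nat,
  (1 <= r1 <= q1)%nat -> (1 <= r2 <= q2)%nat ->
  forall Z1 Z2 : C -> C,
  is_zeta_ap r1 q1 Z1 -> is_zeta_ap r2 q2 Z2 ->
  forall k : nat,
  is_int_1_infty
    (fun x => (ln x ^ k - INR k * ln x ^ (k - 1)) / x ^ 2
              * Delta2 r1 q1 r2 q2 Z1 Z2 x)
    (sum_n (fun i => Binomial.C k i * gamma_EL (k - i) r2 q2 * gamma_EL i r1 q1) k
     + INR (1 / (k + 1))
       * (1 / (INR q1 * INR q2) - gamma_EL 0 r1 q1 / INR q2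
          - gamma_EL 0 r2 q2 / INR q1)
     - gamma_EL (k + 1) r2 q2 / (INR q1 * INR (k + 1))
     - gamma_EL (k + 1) r1 q1 / (INR q2 * INR (k + 1)))
  /\
  forall alpha : R, 131 / 416 < alpha < 1 ->
  is_int_1_infty
    (fun x => (alpha * ln x ^ k - INR k * ln x ^ (k - 1)) / Rpower x (1 + alpha)
              * Delta2 r1 q1 r2 q2 Z1 Z2 x)
    (sum_n (fun l => Binomial.C k l * zeta_const l alpha r1 q1
                     * zeta_const (k - l) alpha r2 q2) k
     + INR (1 / (k + 1))
       * (1 / (INR q1 * INR q2) - gamma_EL 0 r1 q1 / INR q2
          - gamma_EL 0 r2 q2 / INR q1)
     - 1 / (INR q1 * INR q2) * (INR (fact (k + 1)) / (alpha - 1) ^ (k + 2))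
     - (gamma_EL 0 r1 q1 / INR q2 + gamma_EL 0 r2 q2 / INR q1)
       * (INR (fact k) / (alpha - 1) ^ (k + 1))).
Proof.
  intros r1 q1 r2 q2 Hr1 Hr2 Z1 Z2 HZ1 HZ2 k.
  split; [ | intros alpha Halpha ].
  - rewrite <- integral_limit_1 by lia.
    (* [Phi k x / x] is [ln x ^ (k + 1) / x] up to the factor [/ INR (k + 1)], hence the single
       entry of [rho] at [k + 1]. *)
    edestruct (integral_main 1 k r1 q1 r2 q2 (fun j x => ln x ^ (j + 1) / INR (j + 1))
      (fun l => if Nat.eqb l (k + 1) then / INR (k + 1) else 0))
      as [V [HV HL]]; [ lra | assumption | assumption | | | ].
    + intros j x Hx. now apply is_derive_ln_pow.
    + intros x Hx. rewrite sum_n_last. unfold logpow.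
      rewrite Rpower_Ropp, Rpower_1 by assumption. field.
      split; [ lra | apply not_0_INR; lia ].
    + apply is_int_1_infty_ext with (2 := is_int_1_infty_of_lim _ V _ HV HL).
      intros x Hx. rewrite (Delta2_eq r1 q1 r2 q2 Z1 Z2 x) by (assumption || lra).
      unfold logpow'. rewrite Rpower_Ropp, Rpower_1 by lra. field. lra.
  - assert (Ha : alpha <> 1) by lra. rewrite <- integral_limit_lt_1 by (assumption || lia).
    edestruct (integral_main alpha k r1 q1 r2 q2 (fun j x => I_main j x alpha)
      (fun l => if Nat.leb l k then Binomial.C k l * I_main (k - l) 1 alpha else 0))
      as [V [HV HL]]; [ lra | assumption | assumption | | | ].
    + intros j x Hx. now apply is_derive_I_main.
    + intros x Hx. rewrite sum_n_up_to. now apply I_main_logpow.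
    + apply is_int_1_infty_ext with (2 := is_int_1_infty_of_lim _ V _ HV HL).
      intros x Hx. rewrite (Delta2_eq r1 q1 r2 q2 Z1 Z2 x) by (assumption || lra).
      unfold logpow'. rewrite Rpower_plus, Rpower_1, Rpower_Ropp by lra.
      field. split; [ apply Rgt_not_eq, Rpower_pos | lra ].
Qed.
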